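(* Let $\beta\in\mathbb{R}\setminus\{0\}$ and let $X^\beta$ be the vector field on $\mathbb{R}^3$ given by $X^\beta(x,y,z)=(yz+\beta y)\partial_x+(xz-\beta x)\partial_y-xy\,\partial_z$. Let $M\neq0$ and $\Sigma_{M^2}:=\{(x,y,z)\in\mathbb{R}^3:\tfrac12(x^2+y^2)+z^2=M^2\}$, which contains the equilibrium $(0,0,M)$ and to which $X^\beta$ is tangent. Then: (a) the characteristic polynomial of the linearization of $X^\beta|_{\Sigma_{M^2}}$ at $(0,0,M)$ is $\mu^2+(\beta^2-M^2)$; (b) if $|\beta|<|M|$, $(0,0,M)$ is an unstable equilibrium of $X^\beta|_{\Sigma_{M^2}}$; (c) if $|\beta|>|M|$, $(0,0,M)$ is a Lyapunov stable equilibrium of $X^\beta|_{\Sigma_{M^2}}$; (d) if $|\beta|>|M|$, there exist $\varepsilon_0>0$ and a one-parameter family $\{\gamma_\varepsilon\}_{0<\varepsilon\le\varepsilon_0}\subset\Sigma_{M^2}$ of periodic orbits of $X^\beta|_{\Sigma_{M^2}}$ (hence of $X^\beta$) shrinking to $(0,0,M)$ as $\varepsilon\to0$, with periods $T_\varepsilon\to 2\pi/\sqrt{\beta^2-M^2}$ as $\varepsilon\to0$; moreover $\{(0,0,M)\}\cup\bigcup_{0<\varepsilon<\varepsilon_0}\gamma_\varepsilon$ is the connected component of $\Sigma_{M^2}\setminus\gamma_{\varepsilon_0}$ containing $(0,0,M)$.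
   Context: The linearization of a vector field $Y$ at an equilibrium $m$ (here of the restricted field on the surface $\Sigma_{M^2}$) is the linear endomorphism $v\mapsto\frac{\mathrm{d}}{\mathrm{d}t}(\mathrm{D}F^Y_t(m)v)|_{t=0}$ of the tangent space at $m$, $F^Y_t$ the flow. *)

(* Defs.v *)
From HB Require Import structures.
From mathcomp Require Import all_boot all_order all_algebra.
From mathcomp Require Import all_classical all_reals all_analysis.
Set Implicit Arguments. Unset Strict Implicit. Unset Printing Implicit Defensive.
Import Order.TTheory GRing.Theory Num.Theory.
Import numFieldNormedType.Exports.
Local Open Scope classical_set_scope.
Local Open Scope ring_scope.

Section Defs.
Variable R : realType.
Notation pt := 'rV[R]_3.

Definition px (p : pt) : R := p ord0 (inord 0).
Definition py (p : pt) : R := p ord0 (inord 1).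
Definition pz (p : pt) : R := p ord0 (inord 2).

Definition mkpt (x y z : R) : pt := \row_(i < 3) [:: x; y; z]`_i.

Definition Xbeta (beta : R) (p : pt) : pt :=
  mkpt (py p * pz p + beta * py p) (px p * pz p - beta * px p) (- (px p * py p)).

Definition Cas (p : pt) : R := 2^-1 * (px p ^+ 2 + py p ^+ 2) + pz p ^+ 2.

Definition Sigma (M : R) : set pt := [set p | Cas p = M ^+ 2].

(* tangent space of the regular level set Sigma at p : kernel of dC(p) *)
Definition tangent_space (p : pt) : set pt := [set v | 'D_v Cas p = 0].

Definition is_flow (Y : pt -> pt) (F : R -> pt -> pt) : Prop :=
  (forall p, F 0 p = p) /\
  (forall (t : R) (p : pt), is_derive t (1 : R) (fun s : R => F s p) (Y (F t p))).

Definition linearization (F : R -> pt -> pt) (m : pt) (v : pt) : pt :=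
  'D_1 (fun t : R => 'D_v (F t) m) 0.

Definition lyapunov_stable_on (S : set pt) (F : R -> pt -> pt) (m : pt) : Prop :=
  forall eps : R, 0 < eps -> exists2 delta : R, 0 < delta &
    forall p, S p -> `|p - m| < delta -> forall t : R, 0 <= t -> `|F t p - m| < eps.

Definition periodic_orbit (F : R -> pt -> pt) (gamma : set pt) (T : R) : Prop :=
  0 < T /\ exists p, gamma = [set F t p | t in [set: R]] /\
    F T p = p /\ (forall s, 0 < s < T -> F s p != p).
End Defs.

(* Main.v *)
(* The functions [x^2/2 + y^2/2 + z^2] and [K = 4 beta (M - z) - (x^2 - y^2)] are first
   integrals, and for [|M| < |beta|] the distance to the pole [(0, 0, M)] on the ellipsoid is
   controlled by [|K|]; this gives stability.  If [|beta| < |M|], then [xy] (up to sign) grows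
   exponentially near the pole.  For [|M| < |beta|] the projection to the rescaled [(x, y)]-plane
   rotates around the origin with angular speed bounded below, and [K] is strictly monotone along
   rays, so that every level of [K] strictly between its values at the two poles is a single
   periodic orbit; its period tends to that of the linearized rotation because the angular speed
   does.  The disk bounded by a level is the union of the connected sets formed by an orbit and a
   meridian arc to the pole.  For the linearization, differentiability of the flow at the pole
   comes from a Gronwall comparison with the explicit solution of the linear equation. *)
Require Import Defs.
From HB Require Import structures.
From mathcomp Require Import all_boot all_order all_algebra.
From mathcomp Require Import all_classical all_reals all_analysis.
From mathcomp Require Import ring lra.
Import Order.TTheory GRing.Theory Num.Theory.
Import numFieldNormedType.Exports.
Local Open Scope classical_set_scope.
Local Open Scope ring_scope.

(** * Calculus on the real line *)

Section Calculus.
Variable R : realType.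
Implicit Types (f g : R -> R) (x a b c : R).

Lemma is_derive_const c x : is_derive x (1 : R) (fun _ : R => c) 0.
Proof. exact: is_derive_cst. Qed.

Lemma is_derive_var x : is_derive x (1 : R) (fun s : R => s) 1.
Proof. exact: is_derive_id. Qed.

Lemma is_derive_add f g x a b : is_derive x 1 f a -> is_derive x 1 g b ->
  is_derive x 1 (fun s => f s + g s) (a + b).
Proof. by move=> fa gb; exact: is_deriveD. Qed.

Lemma is_derive_opp f x a : is_derive x 1 f a ->
  is_derive x 1 (fun s => - f s) (- a).
Proof. by move=> fa; exact: is_deriveN. Qed.

Lemma is_derive_mul f g x a b : is_derive x 1 f a -> is_derive x 1 g b ->
  is_derive x 1 (fun s => f s * g s) (f x * b + g x * a).
Proof. by move=> fa gb; exact: is_deriveM. Qed.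

Lemma is_derive_sqr f x a : is_derive x 1 f a ->
  is_derive x 1 (fun s => f s ^+ 2) (2 * f x * a).
Proof.
move=> fa; have -> : (fun s => f s ^+ 2) = (fun s => f s * f s).
  by apply/funext => s; rewrite expr2.
by notypeclasses refine (is_derive_eq (is_derive_mul _ _ _ _ _ fa fa) _); ring.
Qed.

Lemma is_derive_expR_comp f x a : is_derive x 1 f a ->
  is_derive x 1 (fun s => expR (f s)) (expR (f x) * a).
Proof. by move=> fa; exact: (@is_derive1_comp R expR f). Qed.

Lemma is_derive_sin_comp f x a : is_derive x 1 f a ->
  is_derive x 1 (fun s => sin (f s)) (cos (f x) * a).
Proof. by move=> fa; exact: (@is_derive1_comp R sin f). Qed.

Lemma is_derive_cos_comp f x a : is_derive x 1 f a ->
  is_derive x 1 (fun s => cos (f s)) (- sin (f x) * a).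
Proof. by move=> fa; exact: (@is_derive1_comp R cos f). Qed.

Lemma is_derive_continuous f x a : is_derive x 1 f a -> {for x, continuous f}.
Proof.
by move=> fa; apply/differentiable_continuous/derivable1_diffP; exact: ex_derive.
Qed.

End Calculus.

(* Plain [apply] would let typeclass resolution close the premises with other
   instances, giving derivatives written with [*:]. *)
Ltac derive_tac :=
  repeat first
    [ match goal with H : _ |- is_derive _ _ _ _ => exact H || exact (H _) end
    | notypeclasses refine (is_derive_const _ _ _)
    | notypeclasses refine (is_derive_var _ _)
    | notypeclasses refine (is_derive_add _ _ _ _ _ _ _ _)
    | notypeclasses refine (is_derive_opp _ _ _ _ _)
    | notypeclasses refine (is_derive_sqr _ _ _ _ _)
    | notypeclasses refine (is_derive_mul _ _ _ _ _ _ _ _)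
    | notypeclasses refine (is_derive_expR_comp _ _ _ _ _)
    | notypeclasses refine (is_derive_sin_comp _ _ _ _ _)
    | notypeclasses refine (is_derive_cos_comp _ _ _ _ _) ].

Ltac derive_eq_tac := notypeclasses refine (is_derive_eq _ _); [derive_tac|cbv beta].

(** * Mean value consequences, Gronwall's inequality and primitives *)

Section MeanValue.
Variable R : realType.
Implicit Types (f g : R -> R) (x a b c : R).

Lemma mean_value f df a b : a < b ->
  (forall t, a <= t <= b -> is_derive t (1 : R) f (df t)) ->
  exists2 t, a < t < b & f b - f a = df t * (b - a).
Proof.
move=> ab fd; have [||t] := @MVT R f df a b ab.
- by move=> t; rewrite in_itv /= => /andP[/ltW at_ /ltW tb]; apply: fd; rewrite at_ tb.
- apply: continuous_in_subspaceT => t; rewrite inE /= in_itv /= => tab.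
  exact: is_derive_continuous (fd _ tab).
- by rewrite in_itv /= => tab ->; exists t.
Qed.

Lemma derive_ge0_homo f df a b : a <= b ->
  (forall t, a <= t <= b -> is_derive t (1 : R) f (df t)) ->
  (forall t, a <= t <= b -> 0 <= df t) -> f a <= f b.
Proof.
rewrite le_eqVlt => /predU1P[-> //|ab] fd df0.
have [t /andP[/ltW at_ /ltW tb] e] := mean_value _ _ _ _ ab fd.
rewrite -subr_ge0 e mulr_ge0 //; first by apply: df0; rewrite at_ tb.
by rewrite subr_ge0 ltW.
Qed.

Lemma derive0_cst f a b : a <= b ->
  (forall t, a <= t <= b -> is_derive t (1 : R) f 0) -> f b = f a.
Proof.
rewrite le_eqVlt => /predU1P[-> //|ab] fd.
have [t _] := mean_value f (fun _ => 0) _ _ ab fd.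
by rewrite mul0r => /eqP; rewrite subr_eq0 => /eqP.
Qed.

(** The function [(E s + c / K) * expR (- (K * s))] is nonincreasing, because its derivative has the
    sign of [dE s - K * E s - c]. *)
Lemma gronwall_ge0 (E dE : R -> R) (K c t : R) : 0 < K -> 0 <= c -> 0 <= t ->
  (forall s, 0 <= s <= t -> is_derive s (1 : R) E (dE s)) ->
  (forall s, 0 <= s <= t -> dE s <= K * E s + c) ->
  E t <= (E 0 + c / K) * expR (K * t).
Proof.
move=> K0 c0 t0 Ed Ele.
pose f s := - ((E s + c / K) * expR (- (K * s))).
pose df s := (K * E s + c - dE s) * expR (- (K * s)).
have : f 0 <= f t.
  apply: (@derive_ge0_homo f df 0 t t0) => s st.
    have Es := Ed s st; rewrite /f; derive_eq_tac; rewrite /df. by field; rewrite gt_eqF.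
  by rewrite /df mulr_ge0 ?expR_ge0 // subr_ge0 Ele.
rewrite /f lerN2 mulr0 oppr0 expR0 mulr1 expRN ler_pdivrMr ?expR_gt0 //.
by apply: le_trans; rewrite lerDl divr_ge0 // ltW.
Qed.

(** A bound on [|dE|] is preserved by time reversal, so negative times reduce to the one-sided
    inequality. *)
Lemma gronwall (E dE : R -> R) (K c tau : R) : 0 < K -> 0 <= c -> 0 <= tau ->
  (forall s, is_derive s (1 : R) E (dE s)) ->
  (forall s, `|s| <= tau -> `|dE s| <= K * E s + c) ->
  forall t, `|t| <= tau -> E t <= (E 0 + c / K) * expR (K * tau).
Proof.
move=> K0 c0 tau0 Ed Ele t ttau.
(* Since [K * E s + c] dominates an absolute value, it is nonnegative; hence the bound at [|t|] may
   be enlarged to the one at [tau]. *)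
have Ege0 s : `|s| <= tau -> 0 <= E s + c / K.
  move=> /Ele h; have := le_trans (normr_ge0 _) h.
  by rewrite -(pmulr_rge0 (E s + c / K) K0) mulrDr mulrCA divff ?mulr1 ?gt_eqF.
have mono : (E 0 + c / K) * expR (K * `|t|) <= (E 0 + c / K) * expR (K * tau).
  apply: ler_wpM2l; first by apply: Ege0; rewrite normr0.
  by rewrite ler_expR ler_pM2l.
apply: le_trans mono; case: (leP 0 t) => [t0|/ltW t0].
  rewrite (ger0_norm t0) in ttau *.
  apply: (@gronwall_ge0 E dE) => // s /andP[s0 st].
  apply: le_trans (ler_norm _) (Ele _ _).
  by rewrite ger0_norm // (le_trans st).
pose E' s := E (- s); pose dE' s := - dE (- s).
have -> : E t = E' `|t| by rewrite /E' ler0_norm // opprK.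
have -> : E 0 = E' 0 by rewrite /E' oppr0.
apply: (@gronwall_ge0 E' dE') => // s /andP[s0 st].
  rewrite /E' /dE' -mulrN1.
  by apply: (@is_derive1_comp R E (fun s => - s)); derive_tac.
apply: le_trans (ler_norm _) _; rewrite /dE' normrN; apply: Ele.
by rewrite normrN ger0_norm // (le_trans st).
Qed.

(** The primitive is the integral from [a]; at interior points its derivative is two-sided, as
    [is_derive] demands. *)
Lemma primitive_exists f a b : continuous f ->
  exists P : R -> R, forall t, a < t < b -> is_derive t (1 : R) P (f t).
Proof.
move=> fc; exists (fun x => \int[lebesgue_measure]_(t in [set` `[a, x]]) f t)%R.
move=> t /andP[at_ tb].
have fi : lebesgue_measure.-integrable `[a, b] (EFin \o f).
  by apply: continuous_compact_integrable; [exact: segment_compact|exact: continuous_subspaceT].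
have [d <-] := @continuous_FTC1_closed R f a t b tb fi at_ (fc t).
by rewrite derive1E; exact: derivableP.
Qed.
End MeanValue.

(** * Polar angle along a planar solution *)

Section Rotation.
Variable R : realType.
Implicit Types (u v al ga : R -> R).

(** The angle is [acos (a / r)], with its sign opposite to that of [b]. The minus sign before the
    sine makes the angle increase along the rotation u' = v, v' = -u. *)
Lemma polar_form (a b : R) : 0 < a ^+ 2 + b ^+ 2 ->
  exists r th : R, [/\ 0 < r, - pi <= th <= pi, a = r * cos th & b = - (r * sin th)].
Proof.
move=> ab0; set r := Num.sqrt (a ^+ 2 + b ^+ 2).
have r0 : 0 < r by rewrite sqrtr_gt0.
have r2 : r ^+ 2 = a ^+ 2 + b ^+ 2 by rewrite sqr_sqrtr // ltW.
have rn0 : r != 0 by rewrite gt_eqF.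
have b2 : 1 - (a / r) ^+ 2 = (b / r) ^+ 2.
  rewrite !expr_div_n r2; field; by rewrite gt_eqF.
have c1 : -1 <= a / r <= 1.
  by rewrite -ler_norml -(@expr_le1 _ 2) // real_normK ?num_real // -subr_ge0 b2 sqr_ge0.
have ca : cos (acos (a / r)) = a / r by apply: acosK; rewrite in_itv.
have sa : sin (acos (a / r)) = `|b| / r.
  by rewrite sin_acos // b2 sqrtr_sqr normrM normfV (gtr0_norm r0).
have [b0|b0] := leP b 0.
  exists r, (acos (a / r)); split => //.
  - by rewrite acos_lepi // (le_trans _ (acos_ge0 c1)) // oppr_le0 pi_ge0.
  - by rewrite ca mulrC divfK.
  - by rewrite sa ler0_norm //; field.
exists r, (- acos (a / r)); split => //.
- by rewrite lerN2 acos_lepi //= (le_trans _ (pi_ge0 R)) // oppr_le0 acos_ge0.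
- by rewrite cosN ca mulrC divfK.
- by rewrite sinN sa gtr0_norm //; field.
Qed.

(** For u' = al v and v' = -ga u, this is the derivative of the angle in u = r cos th, v = -r sin
    th. It is a weighted mean of [ga] and [al]. *)
Definition angular_speed u v al ga (t : R) : R :=
  (ga t * u t ^+ 2 + al t * v t ^+ 2) / (u t ^+ 2 + v t ^+ 2).

(* In the frame rotated by the primitive [th] of the angular speed, both coordinates
   solve the same scalar linear equation, hence keep their initial signs. *)
Lemma polar_lift u v al ga (L r0 th0 : R) : 0 < L ->
  (forall t, is_derive t (1 : R) u (al t * v t)) ->
  (forall t, is_derive t (1 : R) v (- (ga t * u t))) ->
  continuous al -> continuous ga -> (forall t, 0 < u t ^+ 2 + v t ^+ 2) ->
  0 < r0 -> u 0 = r0 * cos th0 -> v 0 = - (r0 * sin th0) ->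
  exists th r : R -> R, [/\ th 0 = th0,
    forall t, 0 <= t <= L -> is_derive t (1 : R) th (angular_speed u v al ga t) &
    forall t, 0 <= t <= L -> [/\ 0 < r t, u t = r t * cos (th t) & v t = - (r t * sin (th t))]].
Proof.
move=> L0 ud vd alc gac uv0 r00 u0 v0.
have uc : continuous u by move=> t; exact: is_derive_continuous (ud t).
have vc : continuous v by move=> t; exact: is_derive_continuous (vd t).
have r2c : continuous (fun t => (u t * u t + v t * v t)^-1).
  move=> t; apply: cvgV; first by rewrite -!expr2 gt_eqF.
  by apply: cvgD; apply: cvgM; [exact: uc|exact: uc|exact: vc|exact: vc].
(* [lam] is the logarithmic derivative r'/r of the radius; the rotated coordinates [p] and [q] below
   both satisfy f' = lam f. *)
pose lam t := (al t - ga t) * (u t * v t) * (u t * u t + v t * v t)^-1.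
have lamc : continuous lam.
  move=> t; apply: cvgM; last exact: r2c.
  by apply: cvgM; [apply: cvgB; [exact: alc|exact: gac]|apply: cvgM; [exact: uc|exact: vc]].
have gc : continuous (angular_speed u v al ga).
  have -> : angular_speed u v al ga = fun t =>
    (ga t * (u t * u t) + al t * (v t * v t)) * (u t * u t + v t * v t)^-1.
    by apply/funext => t; rewrite /angular_speed !expr2.
  move=> t; apply: cvgM; last exact: r2c.
  by apply: cvgD; apply: cvgM;
    [exact: gac|apply: cvgM; exact: uc|exact: alc|apply: cvgM; exact: vc].
(* The interval is enlarged to (-1, L + 1) so that the primitives are differentiable at the
   endpoints 0 and [L] too. *)
have [P Pd] := primitive_exists _ (angular_speed u v al ga) (-1) (L + 1) gc.
have [Q Qd] := primitive_exists _ lam (-1) (L + 1) lamc.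
have inL t : 0 <= t <= L -> -1 < t < L + 1 by lra.
pose th t := P t + (th0 - P 0).
have thd t : 0 <= t <= L -> is_derive t (1 : R) th (angular_speed u v al ga t).
  by move=> /inL /Pd Pt; rewrite /th; derive_eq_tac; rewrite addr0.
have th00 : th 0 = th0 by rewrite /th addrC subrK.
pose p t := u t * cos (th t) + - (v t * sin (th t)).
pose q t := u t * sin (th t) + v t * cos (th t).
have pE t : 0 <= t <= L -> p t * expR (- Q t) = p 0 * expR (- Q 0).
  move=> /andP[t0 tL]; apply: (@derive0_cst R (fun t => p t * expR (- Q t))) => // s /andP[s0 st].
  have sL : 0 <= s <= L by rewrite s0 (le_trans st).
  have ths := thd s sL; have Qs := Qd s (inL _ sL).
  rewrite /p; derive_eq_tac; rewrite /lam /angular_speed.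
  by field; rewrite -?expr2 gt_eqF.
have qE t : 0 <= t <= L -> q t * expR (- Q t) = q 0 * expR (- Q 0).
  move=> /andP[t0 tL]; apply: (@derive0_cst R (fun t => q t * expR (- Q t))) => // s /andP[s0 st].
  have sL : 0 <= s <= L by rewrite s0 (le_trans st).
  have ths := thd s sL; have Qs := Qd s (inL _ sL).
  rewrite /q; derive_eq_tac; rewrite /lam /angular_speed.
  by field; rewrite -?expr2 gt_eqF.
(* With these initial values [p] stays positive and [q] stays zero, so [p] is the radius. *)
have p0 : p 0 = r0.
  by rewrite /p u0 v0 th00 -[RHS]mulr1 -(cos2Dsin2 th0); ring.
have q0 : q 0 = 0 by rewrite /q u0 v0 th00; ring.
exists th, p; split => // t tL.
have pt0 : 0 < p t.
  by rewrite -(pmulr_lgt0 _ (expR_gt0 (- Q t))) pE // p0 mulr_gt0 // expR_gt0.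
have qt0 : q t = 0.
  by apply/eqP; have /eqP := qE _ tL; rewrite q0 mul0r mulf_eq0 (gt_eqF (expR_gt0 _)) orbF.
split => //.
  by transitivity (p t * cos (th t) + q t * sin (th t));
    [rewrite /p /q -[LHS]mulr1 -(cos2Dsin2 (th t)); ring|rewrite qt0 mul0r addr0].
by transitivity (- (p t * sin (th t)) + q t * cos (th t));
  [rewrite /p /q -[LHS]mulr1 -(cos2Dsin2 (th t)); ring|rewrite qt0 mul0r addr0].
Qed.

(** By the mean value theorem the angle gains at least [glo * L], and the intermediate value theorem
    reaches everything below. *)
Lemma angle_travel (th g : R -> R) (glo D L : R) : 0 < glo -> 0 <= D <= glo * L -> 0 < L ->
  (forall t, 0 <= t <= L -> is_derive t (1 : R) th (g t)) -> (forall t, glo <= g t) ->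
  exists2 t, 0 <= t <= L & th t = th 0 + D.
Proof.
move=> glo0 /andP[D0 DL] L0 thd gge.
have [||t] := @IVT R th 0 L (th 0 + D) (ltW L0).
- apply: derivable_within_continuous => t; rewrite in_itv => /thd tht; exact: ex_derive.
- have [t _ e] := mean_value _ _ _ _ _ L0 thd.
  have : glo * L <= th L - th 0 by rewrite e subr0 ler_pM2r.
  by rewrite ge_min le_max => h; apply/andP; split; apply/orP; [left|right]; lra.
- by rewrite in_itv => tL e; exists t.
Qed.

(** Half-angle formula: cos x = 1 - 2 sin^2 (x/2), and the sine is positive on (0, pi). *)
Lemma cos_lt1 (x : R) : 0 < x < pi *+ 2 -> cos x < 1.
Proof.
move=> xpi; have -> : x = (x / 2) *+ 2 by rewrite -mulr_natr divfK // pnatr_eq0.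
rewrite cos_mulr2n; have : 0 < sin (x / 2) ^+ 2.
  by rewrite exprn_gt0 // sin_gt0_pi //; move: xpi; rewrite -mulr_natr; lra.
by have := cos2Dsin2 (x / 2); rewrite -mulr_natr; lra.
Qed.
End Rotation.
Arguments angular_speed {R}.

(** * First integrals on the ellipsoid *)

Section Levels.
Variable R : realType.
Implicit Types (b N X Y Z : R).

Lemma sphere_height_le N X Y Z : 2^-1 * (X ^+ 2 + Y ^+ 2) + Z ^+ 2 = N ^+ 2 -> `|Z| <= `|N|.
Proof.
move=> e; rewrite -(@ler_pXn2r _ 2) ?nnegrE // !real_normK ?num_real // -e lerDr.
by rewrite mulr_ge0 ?invr_ge0 // addr_ge0 ?sqr_ge0.
Qed.

(** X^2 + Y^2 = 2 (N - Z)(N + Z) and |N + Z| <= 2|N|. Thus near the pole the height alone controls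
    the distance. *)
Lemma sphere_radius_le N X Y Z : 2^-1 * (X ^+ 2 + Y ^+ 2) + Z ^+ 2 = N ^+ 2 ->
  X ^+ 2 + Y ^+ 2 <= 4 * `|N| * `|N - Z|.
Proof.
move=> e; have Zle := sphere_height_le _ _ _ _ e.
have -> : X ^+ 2 + Y ^+ 2 = 2 * ((N - Z) * (N + Z)).
  have -> : X ^+ 2 + Y ^+ 2 = 2 * (N ^+ 2 - Z ^+ 2) by rewrite -e; field.
  by ring.
apply: (@le_trans _ _ (2 * (`|N - Z| * `|N + Z|))).
  by rewrite ler_pM2l // -normrM ler_norm.
have : `|N - Z| * `|N + Z| <= `|N - Z| * (2 * `|N|).
  by apply: ler_wpM2l => //; apply: le_trans (ler_normD _ _) _; lra.
lra.
Qed.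

Lemma dif_sqr_le (a c : R) : `|a ^+ 2 - c ^+ 2| <= a ^+ 2 + c ^+ 2.
Proof. by rewrite ler_norml; have := sqr_ge0 a; have := sqr_ge0 c; lra. Qed.

(** Reverse triangle inequality: the quadratic part is at most X^2 + Y^2 <= 4|N||N - Z|, which the
    linear part 4b(N - Z) dominates when |N| < b. *)
Lemma level_height_le b N X Y Z : 2^-1 * (X ^+ 2 + Y ^+ 2) + Z ^+ 2 = N ^+ 2 -> 0 < b ->
  4 * (b - `|N|) * `|N - Z| <= `|4 * b * (N - Z) - (X ^+ 2 - Y ^+ 2)|.
Proof.
move=> e b0; have h := sphere_radius_le _ _ _ _ e; have h' := dif_sqr_le X Y.
have := lerB_dist (4 * b * (N - Z)) (X ^+ 2 - Y ^+ 2).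
rewrite normrM (gtr0_norm (_ : 0 < 4 * b)); last by rewrite mulr_gt0.
lra.
Qed.

(* Along a meridian of the ellipsoid the first integral is strictly monotone. *)
Lemma same_ray_level b N X Y Z l X' Y' Z' : `|N| < b -> 0 < l ->
  2^-1 * (X ^+ 2 + Y ^+ 2) + Z ^+ 2 = N ^+ 2 ->
  2^-1 * (X' ^+ 2 + Y' ^+ 2) + Z' ^+ 2 = N ^+ 2 ->
  4 * b * (N - Z) - (X ^+ 2 - Y ^+ 2) = 4 * b * (N - Z') - (X' ^+ 2 - Y' ^+ 2) ->
  X' = l * X -> Y' = l * Y -> [/\ X' = X, Y' = Y & Z' = Z].
Proof.
move=> Nb l0 e e' K X'E Y'E.
have Zle := sphere_height_le _ _ _ _ e; have Z'le := sphere_height_le _ _ _ _ e'.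
have h1 : 4 * b * (Z - Z') = (l ^+ 2 - 1) * (X ^+ 2 - Y ^+ 2).
  by move: K; rewrite X'E Y'E !exprMn; lra.
have h2 : 2 * ((Z - Z') * (Z + Z')) = (l ^+ 2 - 1) * (X ^+ 2 + Y ^+ 2).
  by move: e' e; rewrite X'E Y'E !exprMn => e' e; lra.
(* Comparing [h1] with [h2] gives 4b|Z - Z'| <= 2|Z - Z'||Z + Z'| <= 4|N||Z - Z'|, which forces Z =
   Z' because |N| < b. *)
have ZZ' : Z - Z' = 0.
  apply/eqP; rewrite -normr_le0.
  have h3 : `|4 * b * (Z - Z')| <= `|2 * ((Z - Z') * (Z + Z'))|.
    rewrite h1 h2 !normrM ler_wpM2l //.
    by apply: le_trans (dif_sqr_le _ _) _; rewrite ger0_norm // addr_ge0 ?sqr_ge0.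
  have h4 : `|2 * ((Z - Z') * (Z + Z'))| <= 4 * `|N| * `|Z - Z'|.
    rewrite !normrM [`|2|]ger0_norm //.
    have : `|Z - Z'| * `|Z + Z'| <= `|Z - Z'| * (2 * `|N|).
      by apply: ler_wpM2l => //; apply: le_trans (ler_normD _ _) _; lra.
    lra.
  have b0 : 0 < b by apply: le_lt_trans Nb.
  have h5 : 4 * (b - `|N|) * `|Z - Z'| <= 0.
    move: (le_trans h3 h4); rewrite normrM (gtr0_norm (_ : 0 < 4 * b)) ?mulr_gt0 //; lra.
  by rewrite -(pmulr_rle0 _ (_ : 0 < 4 * (b - `|N|))) // mulr_gt0 // subr_gt0.
have ZE : Z' = Z by lra.
move: h2; rewrite ZZ' mul0r mulr0 => /esym /eqP; rewrite mulf_eq0 => /orP[l1|XY].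
  have l1' : l = 1.
    apply/eqP; rewrite -(@eqrXn2 _ 2) // ?expr1n; last exact: ltW.
    by rewrite -subr_eq0.
  by rewrite X'E Y'E ZE l1' !mul1r.
move: XY; rewrite paddr_eq0 ?sqr_ge0 // !sqrf_eq0 => /andP[/eqP X0 /eqP Y0].
by rewrite X'E Y'E X0 Y0 !mulr0.
Qed.

(** Integral curves are described by three scalar functions rather than by a flow, so that a flow
    line with reflected coordinates qualifies with [b] equal to the absolute value of [beta]. *)
Definition solution b (x y z : R -> R) : Prop := [/\
  forall t, is_derive t (1 : R) x ((z t + b) * y t),
  forall t, is_derive t (1 : R) y ((z t - b) * x t) &
  forall t, is_derive t (1 : R) z (- (x t * y t))].

Lemma solution_casimir b (x y z : R -> R) t : solution b x y z ->
  2^-1 * (x t ^+ 2 + y t ^+ 2) + z t ^+ 2 = 2^-1 * (x 0 ^+ 2 + y 0 ^+ 2) + z 0 ^+ 2.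
Proof.
move=> [xd yd zd].
apply: (@is_derive_0_is_cst R (fun s => 2^-1 * (x s ^+ 2 + y s ^+ 2) + z s ^+ 2)) => s.
by derive_eq_tac; field.
Qed.

Lemma solution_level b N (x y z : R -> R) t : solution b x y z ->
  4 * b * (N - z t) - (x t ^+ 2 - y t ^+ 2) = 4 * b * (N - z 0) - (x 0 ^+ 2 - y 0 ^+ 2).
Proof.
move=> [xd yd zd].
apply: (@is_derive_0_is_cst R (fun s => 4 * b * (N - z s) - (x s ^+ 2 - y s ^+ 2))) => s.
by derive_eq_tac; ring.
Qed.
End Levels.
Arguments solution {R}.

(** * Periods *)

Section Period.
Variable R : realType.
Variables (b N : R) (Nb : `|N| < b).

(** In the coordinates x/P, y/Q the linearized equation at (0, 0, N) is a rotation of constant speed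
    [P * Q]. The number [c] bounds both ratios of [P] and [Q] from above, and its inverse bounds
    them from below. *)
Let P := Num.sqrt (b + N).
Let Q := Num.sqrt (b - N).
Let c := P / Q + Q / P.

Let bN : 0 < b + N. Proof. by move: Nb; rewrite ltr_norml; lra. Qed.
Let bN' : 0 < b - N. Proof. by move: Nb; rewrite ltr_norml; lra. Qed.
Let P0 : 0 < P. Proof. by rewrite sqrtr_gt0. Qed.
Let Q0 : 0 < Q. Proof. by rewrite sqrtr_gt0. Qed.
Let P2 : P ^+ 2 = b + N. Proof. by rewrite sqr_sqrtr // ltW. Qed.
Let Q2 : Q ^+ 2 = b - N. Proof. by rewrite sqr_sqrtr // ltW. Qed.
Let PQ : P * Q = Num.sqrt (b ^+ 2 - N ^+ 2).
Proof. by rewrite -sqrtrM ?(ltW bN) //; congr Num.sqrt; ring. Qed.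
Let c0 : 0 < c. Proof. by rewrite addr_gt0 // divr_gt0. Qed.

(* On the level [kappa] the angular speed is at least [(b - `|N|) / c] and differs from the
   linear frequency by at most [c * `|kappa| / (4 * (b - `|N|))]. *)
Definition period_modulus : R :=
  2 * pi * (c / (4 * (b - `|N|))) / ((b - `|N|) / c * Num.sqrt (b ^+ 2 - N ^+ 2)).

Let glo : 0 < (b - `|N|) / c.
Proof. by rewrite divr_gt0 // subr_gt0. Qed.

Lemma period_modulus_ge0 : 0 <= period_modulus.
Proof.
have d0 : 0 < b - `|N| by rewrite subr_gt0.
apply: divr_ge0; last by apply: mulr_ge0; [exact: ltW glo|exact: sqrtr_ge0].
apply: mulr_ge0; first by rewrite mulr_ge0 // pi_ge0.
by apply: divr_ge0; [exact: ltW|rewrite mulr_ge0 // ltW].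
Qed.

Let weighted (A B s t m : R) : 0 <= s -> 0 <= t -> 0 < s + t -> m <= A -> m <= B ->
  m <= (A * s + B * t) / (s + t).
Proof.
move=> s0 t0 st mA mB; rewrite ler_pdivlMr // mulrDr lerD //; exact: ler_wpM2r.
Qed.

(** The excluded values of [kappa] are those at the two poles. The period is the time in which the
    lifted angle gains 2 pi: the solution is then on its initial ray and level, hence at its initial
    point by [same_ray_level]. Any other point of the level is reached when the angle agrees with
    its own. *)
Lemma solution_periodic (x y z : R -> R) (kappa : R) : solution b x y z ->
  2^-1 * (x 0 ^+ 2 + y 0 ^+ 2) + z 0 ^+ 2 = N ^+ 2 ->
  4 * b * (N - z 0) - (x 0 ^+ 2 - y 0 ^+ 2) = kappa ->
  kappa != 0 -> kappa != 8 * b * N ->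
  exists T : R, [/\ 0 < T,
    [/\ x T = x 0, y T = y 0 & z T = z 0],
    forall s, 0 < s < T -> ~ (x s = x 0 /\ y s = y 0),
    forall X Y Z, 2^-1 * (X ^+ 2 + Y ^+ 2) + Z ^+ 2 = N ^+ 2 ->
      4 * b * (N - Z) - (X ^+ 2 - Y ^+ 2) = kappa ->
      exists t, [/\ x t = X, y t = Y & z t = Z] &
    `|T - 2 * pi / Num.sqrt (b ^+ 2 - N ^+ 2)| <= period_modulus * `|kappa|].
Proof.
move=> sol S0 K0 k0 k1; have [xd yd zd] := sol.
have S t : 2^-1 * (x t ^+ 2 + y t ^+ 2) + z t ^+ 2 = N ^+ 2 by rewrite (solution_casimir R b).
have K t : 4 * b * (N - z t) - (x t ^+ 2 - y t ^+ 2) = kappa by rewrite (solution_level R b).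
have b0 : 0 < b by apply: le_lt_trans Nb.
have d0 : 0 < b - `|N| by rewrite subr_gt0.
have Pn0 : P != 0 by rewrite gt_eqF.
have Qn0 : Q != 0 by rewrite gt_eqF.
(* Only the two poles project to the origin of the plane, and neither lies on the level. *)
have off X Y Z : 2^-1 * (X ^+ 2 + Y ^+ 2) + Z ^+ 2 = N ^+ 2 ->
    4 * b * (N - Z) - (X ^+ 2 - Y ^+ 2) = kappa -> 0 < (X / P) ^+ 2 + (Y / Q) ^+ 2.
  move=> SX KX; rewrite lt_def addr_ge0 ?sqr_ge0 // andbT paddr_eq0 ?sqr_ge0 //.
  rewrite !sqrf_eq0 !mulf_eq0 !invr_eq0 (negPf Pn0) (negPf Qn0) !orbF.
  apply/negP => /andP[/eqP X0 /eqP Y0]; move: SX KX; rewrite X0 Y0 expr0n /= addr0 mulr0 add0r.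
  move=> /eqP; rewrite eqf_sqr => /orP[] /eqP ->; rewrite !subr0 => KX.
    by move/eqP: k0; apply; rewrite -KX; ring.
  by move/eqP: k1; apply; rewrite -KX; ring.
pose u t := x t * P^-1; pose v t := y t * Q^-1.
pose al t := (z t + b) * (Q / P); pose ga t := (b + - z t) * (P / Q).
have uv0 t : 0 < u t ^+ 2 + v t ^+ 2 by exact: (off (x t) (y t) (z t)).
have zc : continuous z by move=> t; exact: is_derive_continuous (zd t).
have alc : continuous al.
  by move=> t; apply: cvgM; [apply: cvgD; [exact: zc|exact: cvg_cst]|exact: cvg_cst].
have gac : continuous ga.
  by move=> t; apply: cvgM; [apply: cvgD; [exact: cvg_cst|apply: cvgN; exact: zc]|exact: cvg_cst].
have ud t : is_derive t (1 : R) u (al t * v t).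
  by rewrite /u; derive_eq_tac; rewrite /al /v; field; rewrite Pn0 Qn0.
have vd t : is_derive t (1 : R) v (- (ga t * u t)).
  by rewrite /v; derive_eq_tac; rewrite /ga /u; field; rewrite Pn0 Qn0.
pose g := angular_speed u v al ga.
have Zle t := sphere_height_le _ _ _ _ _ (S t).
have cge : forall r : R, 0 < r -> (r + r^-1)^-1 <= r.
  move=> r r0; rewrite -[leRHS]invrK lef_pV2 ?posrE ?addr_gt0 ?invr_gt0 //.
  by rewrite lerDr ltW.
have PQc : c^-1 <= P / Q by have := cge (P / Q) (divr_gt0 P0 Q0); rewrite invf_div.
have QPc : c^-1 <= Q / P by have := cge (Q / P) (divr_gt0 Q0 P0); rewrite invf_div addrC.
have gge t : (b - `|N|) / c <= g t.
  have := Zle t; rewrite ler_norml => /andP[z1 z2].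
  apply: weighted; rewrite ?sqr_ge0 //.
  - by apply: ler_pM => //; rewrite ?(ltW d0) ?invr_ge0 ?(ltW c0) //; lra.
  - by apply: ler_pM => //; rewrite ?(ltW d0) ?invr_ge0 ?(ltW c0) //; lra.
(* [al] and [ga] differ from [P * Q] by multiples of z - N with factors Q/P and P/Q; their weighted
   mean [g] inherits the bound. *)
have gP t : `|g t - P * Q| <= c * `|N - z t|.
  have alE : al t - P * Q = Q / P * (z t - N).
    by rewrite /al (_ : z t - N = z t + b - P ^+ 2); [field|rewrite P2; ring].
  have gaE : ga t - P * Q = P / Q * (N - z t).
    by rewrite /ga (_ : N - z t = b - z t - Q ^+ 2); [field|rewrite Q2; ring].
  have gE : g t - P * Q = ((ga t - P * Q) * u t ^+ 2 + (al t - P * Q) * v t ^+ 2) /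
      (u t ^+ 2 + v t ^+ 2) by rewrite /g /angular_speed; field; rewrite gt_eqF.
  have aB : `|al t - P * Q| <= c * `|N - z t|.
    rewrite alE normrM gtr0_norm ?divr_gt0 // distrC ler_wpM2r //.
    by rewrite /c lerDr ltW // divr_gt0.
  have gB : `|ga t - P * Q| <= c * `|N - z t|.
    rewrite gaE normrM gtr0_norm ?divr_gt0 // ler_wpM2r //.
    by rewrite /c lerDl ltW // divr_gt0.
  rewrite gE normrM normfV (gtr0_norm (uv0 t)) ler_pdivrMr //.
  apply: le_trans (ler_normD _ _) _; rewrite mulrDr (normrM _ (u t ^+ 2)) (normrM _ (v t ^+ 2)) !(ger0_norm (sqr_ge0 _)).
  by rewrite lerD // ler_wpM2r // sqr_ge0.
have [r0 [th0 [r00 th0pi u0 v0]]] := polar_form _ _ _ (uv0 0).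
(* Time for two full turns: initial and target angles lie in [-pi, pi], so th1 + 2 pi - th0, used
   below to reach a given point, lies in [0, 4 pi]. *)
pose L := 4 * pi / ((b - `|N|) / c).
have L0 : 0 < L by rewrite divr_gt0 // mulr_gt0 // pi_gt0.
have Lglo : (b - `|N|) / c * L = 4 * pi by rewrite mulrC divfK // gt_eqF.
have [th [r [thE thd lift]]] := polar_lift _ _ _ _ _ _ _ _ L0 ud vd alc gac uv0 r00 u0 v0.
have pi0 := pi_gt0 R.
have reach D : 0 <= D <= 4 * pi -> exists2 t, 0 <= t <= L & th t = th0 + D.
  move=> Dpi; rewrite -thE; apply: angle_travel L0 thd gge => //.
  by rewrite Lglo.
have hit X Y Z : 2^-1 * (X ^+ 2 + Y ^+ 2) + Z ^+ 2 = N ^+ 2 ->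
    4 * b * (N - Z) - (X ^+ 2 - Y ^+ 2) = kappa -> forall t r1, 0 <= t <= L -> 0 < r1 ->
    X / P = r1 * cos (th t) -> Y / Q = - (r1 * sin (th t)) -> [/\ x t = X, y t = Y & z t = Z].
  move=> SX KX t r1 tL r10 XE YE; have [rt0 ut vt] := lift t tL.
  apply: (same_ray_level _ b N _ _ _ (r t / r1)) => //.
  - by rewrite divr_gt0.
  - by rewrite KX K.
  - by rewrite -[x t](divfK Pn0) -[X](divfK Pn0) XE; rewrite /u in ut; rewrite ut; field; rewrite gt_eqF.
  - by rewrite -[y t](divfK Qn0) -[Y](divfK Qn0) YE; rewrite /v in vt; rewrite vt; field; rewrite gt_eqF.
have [T TL thT] : exists2 t, 0 <= t <= L & th t = th0 + pi *+ 2.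
  by apply: reach; rewrite -mulr_natr; lra.
have T0 : 0 < T.
  move: TL => /andP[]; rewrite le_eqVlt => /predU1P[T0|//] _.
  by move: thT; rewrite -T0 thE -mulr_natr; lra.
have thT' : th T - th 0 = 2 * pi by rewrite thT thE -mulr_natr; ring.
have thdT t : 0 <= t <= T -> is_derive t (1 : R) th (g t).
  by move=> /andP[t0 tT]; apply: thd; move: TL => /andP[_ TL]; rewrite t0 (le_trans tT).
exists T; split => //.
- apply: (hit _ _ _ (S 0) (K 0) T r0) => //.
  + by rewrite thT cosD2pi.
  + by rewrite thT sinD2pi.
(* At an earlier return the angle has advanced strictly between 0 and 2 pi, so the cosine of the
   advance is below 1. Yet the scalar product of two equal planar vectors makes this cosine 1. *)
- move=> s /andP[s0 sT] [xs ys].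
  have sL : 0 <= s <= L by rewrite (ltW s0) /=; move: TL => /andP[_]; apply: le_trans; exact: ltW.
  have [rs0 us vs] := lift s sL.
  have us0 : u s = u 0 by rewrite /u xs.
  have vs0 : v s = v 0 by rewrite /v ys.
  have th0s : 0 < th s - th 0.
    have [t _ ->] : exists2 t, 0 < t < s & th s - th 0 = g t * (s - 0).
      by apply: mean_value => // t /andP[t0 ts]; apply: thdT; rewrite t0 (le_trans ts) // ltW.
    by rewrite subr0 mulr_gt0 // (lt_le_trans glo).
  have thsT : 0 < th T - th s.
    have [t _ ->] : exists2 t, s < t < T & th T - th s = g t * (T - s).
      by apply: mean_value => // t /andP[t0 ts]; apply: thdT; rewrite ts (le_trans _ t0) // ltW.
    by rewrite mulr_gt0 ?subr_gt0 // (lt_le_trans glo).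
  have : cos (th s - th 0) < 1 by apply: cos_lt1; rewrite -mulr_natr; lra.
  have rE : r0 * (r s * cos (th s - th 0)) = r0 * r0.
    rewrite cosB thE; transitivity (u 0 * u s + v 0 * v s); first by rewrite u0 v0 us vs; ring.
    by rewrite us0 vs0 u0 v0 -[RHS]mulr1 -(cos2Dsin2 th0); ring.
  have rE' : r s ^+ 2 = r0 ^+ 2.
    transitivity (u s ^+ 2 + v s ^+ 2).
      by rewrite us vs -[LHS]mulr1 -(cos2Dsin2 (th s)); ring.
    by rewrite us0 vs0 u0 v0 -[RHS]mulr1 -(cos2Dsin2 th0); ring.
  have rs : r s = r0 by apply/eqP; rewrite -(@eqrXn2 _ 2) ?(ltW rs0) ?(ltW r00) // rE'.
  move: rE; rewrite rs => /(mulfI (lt0r_neq0 r00)) => h.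
  by rewrite -(ltr_pM2l r00) h mulr1 ltxx.
- move=> X Y Z SX KX.
  have [r1 [th1 [r10 th1pi XE YE]]] := polar_form _ _ _ (off _ _ _ SX KX).
  have [t tL tht] : exists2 t, 0 <= t <= L & th t = th0 + (th1 + pi *+ 2 - th0).
    by apply: reach; move: th0pi th1pi; rewrite -mulr_natr; lra.
  have thtE : th t = th1 + pi *+ 2 by rewrite tht; ring.
  by exists t; apply: (hit _ _ _ SX KX t r1) => //; rewrite thtE ?cosD2pi ?sinD2pi.
(* The mean value theorem gives 2 pi = g(t) T for some t, so the error in the period comes from that
   of the angular speed at a single time. *)
- have [t _] := mean_value _ _ _ _ _ T0 thdT; rewrite subr0 thT' => tE.
  have gt0 : 0 < g t by rewrite (lt_le_trans glo).
  have w0 : 0 < Num.sqrt (b ^+ 2 - N ^+ 2) by rewrite -PQ mulr_gt0.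
  have TE : T = 2 * pi / g t by rewrite tE mulrC mulKf // gt_eqF.
  have -> : T - 2 * pi / Num.sqrt (b ^+ 2 - N ^+ 2) =
      2 * pi * (Num.sqrt (b ^+ 2 - N ^+ 2) - g t) / (g t * Num.sqrt (b ^+ 2 - N ^+ 2)).
    by rewrite TE; field; rewrite !gt_eqF.
  rewrite normrM normfV (gtr0_norm (mulr_gt0 gt0 w0)) normrM.
  rewrite (gtr0_norm (_ : 0 < 2 * pi)) ?mulr_gt0 // distrC /period_modulus -PQ.
  rewrite [leRHS]mulrAC; apply: ler_pM.
  + by rewrite !mulr_ge0 // ltW.
  + by rewrite invr_ge0 ltW // mulr_gt0 // PQ.
  + rewrite -[leRHS]mulrA ler_wpM2l ?mulr_ge0 ?(ltW pi0) //; apply: le_trans (gP t) _.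
    rewrite -mulrA ler_pM2l // ler_pdivlMl ?mulr_gt0 // -(K t).
    exact: level_height_le.
  + have PQ0 : 0 < P * Q by rewrite mulr_gt0.
    by rewrite lef_pV2 ?posrE ?(ler_pM2r PQ0) ?(mulr_gt0 glo PQ0) ?(mulr_gt0 gt0 PQ0).
Qed.
End Period.

(** * Stability and instability of the pole *)

Section Points.
Variable R : realType.
Implicit Types (p q : 'rV[R]_3) (e : R).

Lemma px_mkpt (x y z : R) : px (mkpt x y z) = x.
Proof. by rewrite /px mxE inordK. Qed.

Lemma py_mkpt (x y z : R) : py (mkpt x y z) = y.
Proof. by rewrite /py mxE inordK. Qed.

Lemma pz_mkpt (x y z : R) : pz (mkpt x y z) = z.
Proof. by rewrite /pz mxE inordK. Qed.

Definition pt_mkptE := (px_mkpt, py_mkpt, pz_mkpt).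

Lemma ord3_ind (Q : 'I_3 -> Prop) : Q (inord 0) -> Q (inord 1) -> Q (inord 2) -> forall i, Q i.
Proof.
move=> Q0 Q1 Q2 [[|[|[|//]]] i]; [move: Q0|move: Q1|move: Q2];
  by congr Q; apply/val_inj; rewrite /= inordK.
Qed.

Lemma pt_eq p q : px p = px q -> py p = py q -> pz p = pz q -> p = q.
Proof. by move=> ex ey ez; apply/rowP; apply: ord3_ind. Qed.

Lemma pxB p q : px (p - q) = px p - px q. Proof. by rewrite /px !mxE. Qed.
Lemma pyB p q : py (p - q) = py p - py q. Proof. by rewrite /py !mxE. Qed.
Lemma pzB p q : pz (p - q) = pz p - pz q. Proof. by rewrite /pz !mxE. Qed.
Lemma pxD p q : px (p + q) = px p + px q. Proof. by rewrite /px !mxE. Qed.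
Lemma pyD p q : py (p + q) = py p + py q. Proof. by rewrite /py !mxE. Qed.
Lemma pzD p q : pz (p + q) = pz p + pz q. Proof. by rewrite /pz !mxE. Qed.
Lemma pxZ e p : px (e *: p) = e * px p. Proof. by rewrite /px !mxE. Qed.
Lemma pyZ e p : py (e *: p) = e * py p. Proof. by rewrite /py !mxE. Qed.
Lemma pzZ e p : pz (e *: p) = e * pz p. Proof. by rewrite /pz !mxE. Qed.

Lemma coord_le_norm p i : `|p ord0 i| <= `|p|.
Proof.
rewrite [leRHS]/Num.Def.normr/= mx_normrE.
exact: (le_bigmax _ (fun ij => `|p ij.1 ij.2|) (ord0, i)).
Qed.

Lemma pt_norm_lt p e : 0 < e -> `|px p| < e -> `|py p| < e -> `|pz p| < e -> `|p| < e.
Proof.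
move=> e0 ex ey ez; rewrite [ltLHS]/Num.Def.normr/= mx_normrE.
apply/bigmax_ltP; split=> // -[i j] _ /=; rewrite (ord1 i).
by move: j; apply: ord3_ind.
Qed.

Lemma is_derive_coord (V : normedModType R) (f : V -> 'rV[R]_3) t v d i :
  is_derive t v f d -> is_derive t v (fun s => f s ord0 i) (d ord0 i).
Proof.
move=> [fd <-]; split; first by move/derivable_mxP : fd => /(_ ord0 i).
by rewrite derive_mx // mxE.
Qed.

Lemma flow_coords (beta : R) F p : is_flow (Xbeta beta) F -> [/\
  forall t, is_derive t (1 : R) (fun s => px (F s p)) ((pz (F t p) + beta) * py (F t p)),
  forall t, is_derive t (1 : R) (fun s => py (F s p)) ((pz (F t p) - beta) * px (F t p)) &
  forall t, is_derive t (1 : R) (fun s => pz (F s p)) (- (px (F t p) * py (F t p)))].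
Proof.
move=> [_ Fd]; split => t.
- notypeclasses refine (is_derive_eq (is_derive_coord _ _ _ _ _ (inord 0) (Fd t p)) _).
  by transitivity (px (Xbeta beta (F t p))); last by rewrite px_mkpt; ring.
- notypeclasses refine (is_derive_eq (is_derive_coord _ _ _ _ _ (inord 1) (Fd t p)) _).
  by transitivity (py (Xbeta beta (F t p))); last by rewrite py_mkpt; ring.
- notypeclasses refine (is_derive_eq (is_derive_coord _ _ _ _ _ (inord 2) (Fd t p)) _).
  by transitivity (pz (Xbeta beta (F t p))); last by rewrite pz_mkpt.
Qed.

(** The conserved quantity 4 beta z + x^2 - y^2 with its sign reversed, shifted to vanish at the
    pole (0, 0, M). *)
Definition first_integral (beta M : R) p : R :=
  4 * beta * (M - pz p) - (px p ^+ 2 - py p ^+ 2).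

Lemma Cas_flow beta F p t : is_flow (Xbeta beta) F -> Cas (F t p) = Cas p.
Proof.
move=> Ff; have := solution_casimir _ beta (fun s => px (F s p)) (fun s => py (F s p)) (fun s => pz (F s p)) t.
by rewrite /= (proj1 Ff); apply; exact: flow_coords.
Qed.

Lemma Sigma_flow beta M F p t : is_flow (Xbeta beta) F -> Sigma M p -> Sigma M (F t p).
Proof. by move=> Ff Sp; rewrite /Sigma /= (Cas_flow beta). Qed.

Lemma first_integral_flow beta M F p t : is_flow (Xbeta beta) F ->
  first_integral beta M (F t p) = first_integral beta M p.
Proof.
move=> Ff; have := solution_level _ beta M (fun s => px (F s p)) (fun s => py (F s p)) (fun s => pz (F s p)) t.
by rewrite /= (proj1 Ff); apply; exact: flow_coords.
Qed.

(* The symmetry [(x, y, z) |-> (x, -y, -z)] exchanges the flows of [beta] and [-beta]. *)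
Lemma flow_solution beta F p : beta != 0 -> is_flow (Xbeta beta) F ->
  solution `|beta| (fun t => px (F t p)) (fun t => Num.sg beta * py (F t p))
    (fun t => Num.sg beta * pz (F t p)).
Proof.
move=> b0 Ff; have [xd yd zd] := flow_coords _ _ p Ff.
have s2 : Num.sg beta * Num.sg beta = 1 by rewrite -expr2 sqr_sg b0.
rewrite normrEsg; split => t.
- notypeclasses refine (is_derive_eq (xd t) _).
  by rewrite -mulrDr mulrACA s2 mul1r.
- derive_eq_tac; rewrite mulr0 addr0; ring.
- derive_eq_tac; rewrite mulr0 addr0; ring.
Qed.

Lemma Sigma_signed beta M p : beta != 0 -> Sigma M p ->
  2^-1 * (px p ^+ 2 + (Num.sg beta * py p) ^+ 2) + (Num.sg beta * pz p) ^+ 2 =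
  (Num.sg beta * M) ^+ 2.
Proof. by move=> b0 Sp; rewrite !exprMn sqr_sg b0 !mul1r. Qed.

Lemma first_integral_signed beta M p : beta != 0 ->
  4 * `|beta| * (Num.sg beta * M - Num.sg beta * pz p) -
    (px p ^+ 2 - (Num.sg beta * py p) ^+ 2) = first_integral beta M p.
Proof.
move=> b0; rewrite exprMn sqr_sg b0 mul1r normrEsg /first_integral -mulrBr.
have s2 : Num.sg beta * Num.sg beta = 1 by rewrite -expr2 sqr_sg b0.
by congr (_ - _); rewrite -[RHS]mul1r -s2; ring.
Qed.

Lemma sg_norm (beta M : R) : beta != 0 -> `|Num.sg beta * M| = `|M|.
Proof. by move=> b0; rewrite normrM normr_sg b0 mul1r. Qed.

Lemma pole_dist_le (beta M : R) p : `|M| < `|beta| -> Sigma M p ->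
  4 * (`|beta| - `|M|) * `|M - pz p| <= `|first_integral beta M p|.
Proof.
move=> Mb Sp; have b0 : beta != 0 by rewrite -normr_gt0 (le_lt_trans _ Mb).
have := level_height_le _ `|beta| _ _ _ _ (Sigma_signed _ _ _ b0 Sp).
rewrite first_integral_signed // -mulrBr !sg_norm //; apply.
by rewrite normr_gt0.
Qed.

(** The first entry of the minimum bounds the height, the second bounds x^2 + y^2 by eta^2 through
    [sphere_radius_le]; the [+ 1] keeps the denominator positive. *)
Lemma pole_near (beta M eta : R) p : `|M| < `|beta| -> Sigma M p -> 0 < eta ->
  `|first_integral beta M p| < 4 * (`|beta| - `|M|) * Num.min eta (eta ^+ 2 / (4 * `|M| + 1)) ->
  `|p - mkpt 0 0 M| < eta.
Proof.
move=> Mb Sp eta0 small.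
have d0 : 0 < 4 * (`|beta| - `|M|) by rewrite mulr_gt0 // subr_gt0.
have := le_lt_trans (pole_dist_le _ _ _ Mb Sp) small.
rewrite ltr_pM2l // lt_min => /andP[z1 z2].
have M1 : 0 < 4 * `|M| + 1 by rewrite ltr_wpDl // mulr_ge0.
have r2 : px p ^+ 2 + py p ^+ 2 < eta ^+ 2.
  apply: le_lt_trans (sphere_radius_le _ _ _ _ _ Sp) _.
  move: z2; rewrite ltr_pdivlMr // => z2; apply: le_lt_trans z2.
  by rewrite mulrDr mulr1 mulrC lerDl.
have sq (a : R) : a ^+ 2 < eta ^+ 2 -> `|a| < eta.
  by rewrite -real_normK ?num_real // ltr_pXn2r // nnegrE ltW.
apply: pt_norm_lt => //; rewrite ?pxB ?pyB ?pzB ?pt_mkptE ?subr0 ?(distrC _ M) //.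
- by apply: sq; apply: le_lt_trans r2; rewrite lerDl sqr_ge0.
- by apply: sq; apply: le_lt_trans r2; rewrite lerDr sqr_ge0.
Qed.

(** The first integral is at most (4|beta| + 2) times the distance to the pole when this distance is
    below 1. Being conserved, it then confines the orbit by [pole_near]. *)
Lemma stable (beta M : R) F : is_flow (Xbeta beta) F -> `|M| < `|beta| ->
  lyapunov_stable_on (Sigma M) F (mkpt 0 0 M).
Proof.
move=> Ff Mb eps eps0.
set k := 4 * (`|beta| - `|M|) * Num.min eps (eps ^+ 2 / (4 * `|M| + 1)).
have k0 : 0 < k.
  have M1 : 0 < 4 * `|M| + 1 by rewrite ltr_wpDl // mulr_ge0.
  by rewrite mulr_gt0 ?mulr_gt0 ?subr_gt0 // lt_min eps0 divr_gt0 // exprn_gt0.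
have c0 : 0 < 4 * `|beta| + 2 by rewrite ltr_wpDl // mulr_ge0.
exists (Num.min 1 (k / (4 * `|beta| + 2))); first by rewrite lt_min ltr01 divr_gt0.
move=> p Sp; rewrite lt_min => /andP[d1 dk] t _.
apply: (pole_near _ _ _ _ Mb) => //; first exact: (Sigma_flow beta).
rewrite (first_integral_flow beta) //; apply: (@le_lt_trans _ _ ((4 * `|beta| + 2) * `|p - mkpt 0 0 M|)).
  have := coord_le_norm (p - mkpt 0 0 M) (inord 0); rewrite -/(px _) pxB px_mkpt subr0.
  have := coord_le_norm (p - mkpt 0 0 M) (inord 1); rewrite -/(py _) pyB py_mkpt subr0.
  have := coord_le_norm (p - mkpt 0 0 M) (inord 2); rewrite -/(pz _) pzB pz_mkpt.
  move: d1; set n := `|p - _| => d1 zn yn xn.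
  have sq (a : R) : `|a| <= n -> a ^+ 2 <= n.
    move=> an; rewrite -real_normK ?num_real // expr2 -[leRHS]mulr1.
    by apply: ler_pM => //; apply: le_trans an (ltW d1).
  apply: le_trans (ler_normB _ _) _; rewrite normrM (normrM 4) (ger0_norm (_ : 0 <= 4)) //.
  rewrite (mulrDl (4 * `|beta|)); apply: lerD; first by rewrite ler_wpM2l ?mulr_ge0 // distrC.
  apply: le_trans (dif_sqr_le _ _ _) _; have := sq _ xn; have := sq _ yn; lra.
by rewrite mulrC -ltr_pdivlMr.
Qed.

(** Let V = sgn(M) x y. While z stays within k = (|M| - |beta|)/2 of M, both sgn(M)(z + beta) and
    sgn(M)(z - beta) are at least k, so V' >= k (x^2 + y^2) >= 2 k V. Exponential growth contradicts
    V <= 1. *)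
Lemma unstable (beta M : R) F : is_flow (Xbeta beta) F -> M != 0 -> `|beta| < `|M| ->
  ~ lyapunov_stable_on (Sigma M) F (mkpt 0 0 M).
Proof.
move=> Ff M0 bM st.
have n0 : 0 < `|M| by rewrite normr_gt0.
pose k := (`|M| - `|beta|) / 2; have k0 : 0 < k by rewrite divr_gt0 // subr_gt0.
pose e := Num.min 1 k; have e0 : 0 < e by rewrite lt_min ltr01.
have [d d0 near_m] := st e e0.
pose s := Num.sg M; have s2 : s * s = 1 by rewrite -expr2 sqr_sg M0.
have sM : s * M = `|M| by rewrite [RHS]normrEsg.
have Ms : M = s * `|M| by rewrite -sM mulrA s2 mul1r.
(* The starting point is (a, s a, s h) on the ellipsoid. The three bounds on [a] make the horizontal
   coordinates small, [h] well defined, and |M| - h small. *)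
pose a := Num.min (d / 2) (Num.min `|M| (Num.sqrt (`|M| * d / 2))).
have a0 : 0 < a.
  by rewrite !lt_min n0 sqrtr_gt0 !divr_gt0 // mulr_gt0.
have [ad aM aMd] : [/\ a <= d / 2, a <= `|M| & a <= Num.sqrt (`|M| * d / 2)].
  by rewrite /a !ge_min !lexx ?orbT.
have a2M : a ^+ 2 <= `|M| ^+ 2 by rewrite ler_pXn2r // nnegrE ltW.
have a2d : a ^+ 2 <= `|M| * d / 2.
  rewrite -[leRHS]sqr_sqrtr ?divr_ge0 ?mulr_ge0 // ?(ltW d0) //.
  by rewrite ler_pXn2r // nnegrE ?sqrtr_ge0 // ltW.
pose h := Num.sqrt (`|M| ^+ 2 - a ^+ 2).
have h2 : h ^+ 2 = `|M| ^+ 2 - a ^+ 2 by rewrite sqr_sqrtr // subr_ge0.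
have h0 : 0 <= h by rewrite sqrtr_ge0.
pose p := mkpt a (s * a) (s * h).
have Sp : Sigma M p.
  rewrite /Sigma /Cas /= !pt_mkptE !exprMn sqr_sg M0 !mul1r h2 real_normK ?num_real //.
  by field.
have pm : `|p - mkpt 0 0 M| < d.
  apply: pt_norm_lt => //; rewrite ?pxB ?pyB ?pzB !pt_mkptE ?subr0.
  - by rewrite gtr0_norm //; lra.
  - by rewrite normrM normr_sg M0 mul1r gtr0_norm //; lra.
  - rewrite {1}Ms -mulrBr normrM normr_sg M0 mul1r distrC ger0_norm.
      (* (|M| - h)|M| <= (|M| - h)(|M| + h) = a^2. *)
      have hM : (`|M| - h) * `|M| <= `|M| * d / 2.
        have -> : `|M| * d / 2 = (d / 2) * `|M| by ring.
        nra.
      have : `|M| - h <= d / 2 by rewrite -(ler_pM2r n0); apply: le_trans hM _; lra.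
      by lra.
    by rewrite subr_ge0 -(@ler_pXn2r _ 2) // ?nnegrE // h2 gerBl sqr_ge0.
have [xd yd zd] := flow_coords _ _ p Ff.
pose V t := s * (px (F t p) * py (F t p)).
have stay t : 0 <= t -> `|F t p - mkpt 0 0 M| < e by exact: near_m.
have V0 : V 0 = a ^+ 2 by rewrite /V (proj1 Ff) !pt_mkptE -[RHS]mul1r -s2; ring.
have V1 t : 0 <= t -> V t <= 1.
  move=> /stay h1; have e1 : e <= 1 by rewrite ge_min lexx.
  have := coord_le_norm (F t p - mkpt 0 0 M) (inord 0); rewrite -/(px _) pxB px_mkpt subr0 => hx.
  have := coord_le_norm (F t p - mkpt 0 0 M) (inord 1); rewrite -/(py _) pyB py_mkpt subr0 => hy.
  apply: le_trans (ler_norm _) _; rewrite !normrM normr_sg M0 mul1r -[leRHS]mulr1.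
  by apply: ler_pM => //; [apply: le_trans hx _|apply: le_trans hy _]; rewrite ltW // (lt_le_trans h1).
have growth t : 0 <= t -> a ^+ 2 * expR (2 * k * t) <= V t.
  move=> t0; pose f u := V u * expR (- (2 * k * u)).
  pose dV u := s * ((pz (F u p) + beta) * py (F u p) ^+ 2 + (pz (F u p) - beta) * px (F u p) ^+ 2).
  have : f 0 <= f t.
    apply: (@derive_ge0_homo R f (fun u => (dV u - 2 * k * V u) * expR (- (2 * k * u))) 0 t) => // u.
      by move=> _; rewrite /f /V; derive_eq_tac; rewrite /dV; ring.
    move=> /andP[u0 _]; rewrite mulr_ge0 ?expR_ge0 // subr_ge0.
    have := coord_le_norm (F u p - mkpt 0 0 M) (inord 2); rewrite -/(pz _) pzB pz_mkpt => hz.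
    have {}hz : `|s * pz (F u p) - `|M| | <= k.
      rewrite -sM -mulrBr normrM normr_sg M0 mul1r; apply: le_trans hz _.
      by rewrite ltW // (lt_le_trans (stay _ u0)) // ge_min lexx orbT.
    have sb : `|s * beta| = `|beta| by rewrite normrM normr_sg M0 mul1r.
    have hb := ler_norm (s * beta); have hb' := ler_norm (- (s * beta)).
    rewrite normrN sb in hb'; rewrite sb in hb.
    have kE : `|M| = 2 * k + `|beta| by rewrite /k; field.
    move: hz; rewrite ler_norml kE => /andP[hz _].
    have A1 : k <= s * (pz (F u p) + beta) by rewrite mulrDr; lra.
    have A2 : k <= s * (pz (F u p) - beta) by rewrite mulrBr; lra.
    apply: (@le_trans _ _ (k * (px (F u p) ^+ 2 + py (F u p) ^+ 2))).
      have -> : 2 * k * V u = k * (2 * V u) by ring.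
      rewrite ler_pM2l // /V.
      have : 2 * (s * (px (F u p) * py (F u p))) <= 2 * `|px (F u p)| * `|py (F u p)|.
        rewrite -mulrA ler_pM2l //; apply: le_trans (ler_norm _) _.
        by rewrite !normrM normr_sg M0 mul1r.
      have := sqr_ge0 (`|px (F u p)| - `|py (F u p)|).
      rewrite sqrrB !real_normK ?num_real //; lra.
    have -> : dV u = s * (pz (F u p) - beta) * px (F u p) ^+ 2 +
        s * (pz (F u p) + beta) * py (F u p) ^+ 2 by rewrite /dV; ring.
    by rewrite mulrDr lerD // ler_wpM2r // sqr_ge0.
  rewrite /f V0 mulr0 oppr0 expR0 mulr1 => h1.
  by rewrite -ler_pdivlMr ?expR_gt0 // -expRN.
have a20 : 0 < a ^+ 2 by rewrite exprn_gt0.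
(* At this time the exponent 2kt equals 1/a^2, and exp(1/a^2) >= 1 + 1/a^2 exceeds the allowed
   1/a^2. *)
pose t := (a ^+ 2)^-1 / (2 * k).
have t0 : 0 <= t by rewrite divr_ge0 ?invr_ge0 ?(ltW a20) // mulr_ge0 // ltW.
have := le_trans (growth t t0) (V1 t t0).
have tk : 2 * k * t = (a ^+ 2)^-1 by rewrite mulrC divfK // gt_eqF // mulr_gt0.
rewrite tk -ler_pdivlMl // mulr1 => h1.
by have := expR_ge1Dx (a ^+ 2)^-1; lra.
Qed.
End Points.
Arguments first_integral {R}.

(** * The family of periodic orbits *)

Section PeriodicFamily.
Variables (R : realType) (beta M : R) (F : R -> 'rV[R]_3 -> 'rV[R]_3).
Hypothesis (Ff : is_flow (Xbeta beta) F) (M0 : M != 0) (Mb : `|M| < `|beta|).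

Let m : 'rV[R]_3 := mkpt 0 0 M.
Let sg := Num.sg (beta * M).
(** Half the energy of the opposite pole, so the levels considered avoid that pole; on the meridian
    x = y it is reached at height 0. *)
Let emax : R := 4 * `|beta * M|.
Let energy (p : 'rV[R]_3) : R := sg * first_integral beta M p.
Let level (e : R) : set 'rV[R]_3 := [set p | Sigma M p /\ energy p = e].

Let b0 : beta != 0. Proof. by rewrite -normr_gt0 (le_lt_trans _ Mb). Qed.
Let nb0 : 0 < `|beta|. Proof. by rewrite normr_gt0. Qed.
Let nM0 : 0 < `|M|. Proof. by rewrite normr_gt0. Qed.
Let emax0 : 0 < emax. Proof. by rewrite mulr_gt0 // normr_gt0 mulf_neq0. Qed.
Let sgE : sg = Num.sg beta * Num.sg M. Proof. exact: sgrM. Qed.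
Let sgb2 : Num.sg beta * Num.sg beta = 1. Proof. by rewrite -expr2 sqr_sg b0. Qed.
Let sgM2 : Num.sg M * Num.sg M = 1. Proof. by rewrite -expr2 sqr_sg M0. Qed.
Let sg2 : sg * sg = 1. Proof. by rewrite -expr2 sqr_sg mulf_neq0. Qed.
Let sgn1 : `|sg| = 1. Proof. by rewrite normr_sg mulf_neq0. Qed.
Let emaxE : emax = 4 * `|beta| * `|M|. Proof. by rewrite /emax normrM mulrA. Qed.

Let energy_level (p : 'rV[R]_3) e : energy p = e -> first_integral beta M p = sg * e.
Proof. by move=> <-; rewrite mulrA sg2 mul1r. Qed.

(** The factor [sg] turns the linear part into 4|beta||M - z|, because |z| <= |M|. So on the
    ellipsoid the energy is nonnegative and vanishes only at the pole. *)
Let energy_ge (p : 'rV[R]_3) : Sigma M p -> 4 * (`|beta| - `|M|) * `|M - pz p| <= energy p.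
Proof.
move=> Sp; have zle := sphere_height_le _ _ _ _ _ Sp.
have rle := sphere_radius_le _ _ _ _ _ Sp.
have dE : `|M - pz p| = Num.sg M * (M - pz p).
  have -> : `|M - pz p| = `|Num.sg M * (M - pz p)| by rewrite normrM normr_sg M0 mul1r.
  rewrite ger0_norm // mulrBr -normrEsg subr_ge0; apply: le_trans zle.
  by apply: le_trans (ler_norm _) _; rewrite normrM normr_sg M0 mul1r.
have -> : energy p = 4 * `|beta| * `|M - pz p| - sg * (px p ^+ 2 - py p ^+ 2).
  by rewrite dE normrEsg /energy /first_integral sgE; ring.
have := ler_norm (sg * (px p ^+ 2 - py p ^+ 2)); rewrite normrM sgn1 mul1r.
have := dif_sqr_le _ (px p) (py p); lra.
Qed.

Let energy_eq0 p : Sigma M p -> energy p <= 0 -> p = m.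
Proof.
move=> Sp e0; have := le_trans (energy_ge _ Sp) e0.
rewrite pmulr_rle0 ?mulr_gt0 ?subr_gt0 // normr_le0 subr_eq0 => /eqP zE.
have := sphere_radius_le _ _ _ _ _ Sp; rewrite -zE subrr normr0 mulr0.
move=> r0; have : px p ^+ 2 + py p ^+ 2 == 0.
  by rewrite eq_le r0 addr_ge0 ?sqr_ge0.
rewrite paddr_eq0 ?sqr_ge0 // !sqrf_eq0 => /andP[/eqP x0 /eqP y0].
by apply: pt_eq; rewrite pt_mkptE.
Qed.

Let Sigma_m : Sigma M m.
Proof. by rewrite /Sigma /Cas /= !pt_mkptE expr0n /= addr0 mulr0 add0r. Qed.

Let energy_m : energy m = 0.
Proof. by rewrite /energy /first_integral !pt_mkptE !subrr mulr0 subrr mulr0. Qed.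

(* On the meridian [x = y] the energy is an affine function of the height. *)
Let height (e : R) : R := Num.sg M * (`|M| - e / (4 * `|beta|)).
Let start (e : R) : 'rV[R]_3 :=
  mkpt (Num.sqrt (M ^+ 2 - height e ^+ 2)) (Num.sqrt (M ^+ 2 - height e ^+ 2)) (height e).

Let height_le e : 0 <= e <= emax -> 0 <= M ^+ 2 - height e ^+ 2.
Proof.
rewrite emaxE => /andP[e0 e1]; rewrite exprMn sqr_sg M0 mul1r -(real_normK (num_real M)).
have d0 : 0 <= e / (4 * `|beta|) by rewrite divr_ge0 // mulr_ge0.
have d1 : e / (4 * `|beta|) <= `|M| by rewrite ler_pdivrMr ?mulr_gt0 // mulrC.
by rewrite subr_ge0 ler_pXn2r // ?nnegrE // ?subr_ge0 // gerBl.
Qed.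

Let start_level e : 0 <= e <= emax -> level e (start e).
Proof.
move=> he; split.
  by rewrite /Sigma /Cas /= !pt_mkptE sqr_sqrtr ?height_le //; field.
rewrite /energy /first_integral !pt_mkptE subrr subr0 sgE.
have -> : M - height e = Num.sg M * (e / (4 * `|beta|)).
  by rewrite /height mulrBr -{1}(mul1r M) -sgM2 -mulrA -normrEsg; ring.
transitivity (Num.sg M * Num.sg M * (Num.sg beta * beta) * 4 * (e / (4 * `|beta|))); first by ring.
by rewrite sgM2 -normrEsg; field; rewrite normr_eq0.
Qed.

Lemma level_periodic e : 0 < e <= emax -> exists T : R, [/\ 0 < T,
  level e = [set F t (start e) | t in [set: R]],
  F T (start e) = start e /\ (forall s, 0 < s < T -> F s (start e) != start e) &
  `|T - 2 * pi / Num.sqrt (beta ^+ 2 - M ^+ 2)| <=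
    period_modulus R `|beta| (Num.sg beta * M) * e].
Proof.
move=> /andP[e0 e1].
have [|Sp Ep] := start_level e; first by rewrite ltW.
have Nb : `|Num.sg beta * M| < `|beta| by rewrite sg_norm.
have sol := flow_solution _ beta F (start e) b0 Ff.
have F0 : F 0 (start e) = start e := proj1 Ff _.
have eN : `|sg * e| = e by rewrite normrM sgn1 mul1r gtr0_norm.
have [||||T [T0 [xT yT zT] Tmin orb Tle]] := solution_periodic _ _ _ Nb _ _ _ (sg * e) sol.
- by rewrite F0; exact: Sigma_signed.
- by rewrite F0 first_integral_signed // (energy_level _ _ Ep).
- by rewrite -normr_gt0 eN.
(* The opposite pole has energy 8|beta||M|, twice [emax]. *)
- apply/eqP => /(congr1 Num.norm); rewrite eN !normrM normr_id normr_sg b0 mul1r (ger0_norm (_ : 0 <= 8)) // => e8.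
  by move: e1; rewrite emaxE e8; have := mulr_gt0 nb0 nM0; lra.
have inj x y : Num.sg beta * x = Num.sg beta * y -> x = y.
  by move=> /(congr1 ( *%R (Num.sg beta))); rewrite !mulrA sgb2 !mul1r.
have norm2 : `|beta| ^+ 2 - (Num.sg beta * M) ^+ 2 = beta ^+ 2 - M ^+ 2.
  by rewrite exprMn sqr_sg b0 mul1r real_normK ?num_real.
exists T; split => //.
- apply/seteqP; split=> [q [Sq Eq]|_ [t _ <-]].
    have [||t [xt yt zt]] := orb (px q) (Num.sg beta * py q) (Num.sg beta * pz q).
    + exact: Sigma_signed.
    + by rewrite first_integral_signed // (energy_level _ _ Eq).
    by exists t => //; apply: pt_eq => //; apply: inj.
  split; first exact: (Sigma_flow _ beta).
  by rewrite /energy (first_integral_flow _ beta).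
- split; first by rewrite -[RHS]F0; apply: pt_eq => //; apply: inj.
  move=> s sT; apply/eqP => Fs; apply: (Tmin s sT).
  by rewrite Fs F0.
- by move: Tle; rewrite eN norm2.
Qed.

Let energy_continuous : continuous energy.
Proof.
have xc : continuous (@px R) by exact: coord_continuous.
have yc : continuous (@py R) by exact: coord_continuous.
have zc : continuous (@pz R) by exact: coord_continuous.
have sqc (f : 'rV[R]_3 -> R) : continuous f -> continuous (f \* f).
  by move=> fc p; exact: continuousM (fc p) (fc p).
have -> : energy = cst sg \* (cst (4 * beta) \* (cst M - @pz R) - (@px R \* @px R - @py R \* @py R)).
  by apply/funext => p; rewrite /energy /first_integral !expr2.
move=> p; apply: continuousM; first exact: cst_continuous.
apply: continuousB; last by apply: continuousB; exact: sqc.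
apply: continuousM; first exact: cst_continuous.
by apply: continuousB; [exact: cst_continuous|exact: zc].
Qed.

Let start_continuous : continuous start.
Proof.
have hc : continuous height.
  move=> e; apply: cvgM; first exact: cvg_cst.
  by apply: cvgB; [exact: cvg_cst|apply: cvgM; [exact: cvg_id|exact: cvg_cst]].
have rc : continuous (fun e => Num.sqrt (M ^+ 2 - height e ^+ 2)).
  have -> : (fun e => Num.sqrt (M ^+ 2 - height e ^+ 2)) =
      (fun e => Num.sqrt (M ^+ 2 - height e * height e)).
    by apply/funext => e; rewrite expr2.
  move=> e; apply: (@continuous_comp _ _ _ (fun e => M ^+ 2 - height e * height e) Num.sqrt).
    by apply: cvgB; [exact: cvg_cst|apply: cvgM; exact: hc].
  exact: sqrt_continuous.
move=> e; apply/cvgrPdist_lt => eta eta0.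
near=> e'; apply: pt_norm_lt => //; rewrite ?pxB ?pyB ?pzB !pt_mkptE;
  near: e'; first [exact: ((@cvgrPdist_lt _ _ _ _ _ _ _).1 (rc e) eta eta0)
                  |exact: ((@cvgrPdist_lt _ _ _ _ _ _ _).1 (hc e) eta eta0)].
Unshelve. all: by end_near. Qed.

Let flow_continuous p : continuous (F ^~ p).
Proof.
move=> t; apply/differentiable_continuous/derivable1_diffP.
by have [d _] := proj2 Ff t p.
Qed.

Let sublevel_connected : connected [set p | Sigma M p /\ energy p < emax].
Proof.
(* Every arc begins at [start 0], which is the pole, and meets its orbit at [start e]; hence each
   set is connected and all share a point. *)
pose C e := [set start t | t in `[0, e]] `|` [set F t (start e) | t in [set: R]].
have -> : [set p | Sigma M p /\ energy p < emax] = \bigcup_(e in [set e | 0 < e < emax]) C e.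
  apply/seteqP; split=> [p [Sp ep]|p [e /andP[e0 e1] [[t ht <-]|[t _ <-]]]] /=.
  (* Here [p] is the pole, which lies on every arc; the index [emax / 2] is an arbitrary admissible
     one. *)
  - have [e0|e0] := leP (energy p) 0.
      exists (emax / 2) => /=; first by move: emax0; lra.
      left; exists 0; first by rewrite /= in_itv /= lexx; move: emax0; lra.
      rewrite (energy_eq0 _ Sp e0); apply: energy_eq0.
        by have [|] := start_level 0; first by rewrite lexx ltW.
      by have [|_ ->] := start_level 0; first by rewrite lexx ltW.
    exists (energy p); first by rewrite /= e0.
    have [|T [_ lE _ _]] := level_periodic (energy p); first by rewrite e0 ltW.
    by right; rewrite -lE.
  - move: ht; rewrite /= in_itv /= => /andP[t0 te].
    have [|S E] := start_level t; first by rewrite t0 (le_trans te) // ltW.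
    by split => //; rewrite E (le_lt_trans te).
  - have [|S E] := start_level e; first by rewrite ltW //= ltW.
    split; first exact: (Sigma_flow _ beta).
    by rewrite /energy (first_integral_flow _ beta) // -/(energy _) E.
apply: bigcup_connected.
  exists m => e /= /andP[e0 e1]; left; exists 0; first by rewrite /= in_itv /= lexx ltW.
  by have [|S E] := start_level 0; [rewrite lexx ltW|apply: energy_eq0; rewrite ?E].
move=> e /andP[e0 e1]; apply: connectedU.
- exists (start e); split; last by exists 0 => //; exact: (proj1 Ff).
  by exists e => //; rewrite /= in_itv /= lexx ltW.
- exact: connected_continuous_connected (@segment_connected _ _ _) (continuous_subspaceT start_continuous).
- apply: connected_continuous_connected (continuous_subspaceT (flow_continuous (start e))).
  by apply/connected_intervalP.
Qed.

Lemma periodic_family :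
  exists (eps0 : R) (gamma : R -> set 'rV[R]_3) (T : R -> R),
    0 < eps0 /\
    (forall eps, 0 < eps <= eps0 ->
       gamma eps `<=` Sigma M /\ periodic_orbit F (gamma eps) (T eps)) /\
    (forall eta : R, 0 < eta -> exists2 d : R, 0 < d &
       forall eps, 0 < eps <= eps0 -> eps < d ->
         forall q, gamma eps q -> `|q - m| < eta) /\
    (T eps @[eps --> 0^'+] --> 2 * pi / Num.sqrt (beta ^+ 2 - M ^+ 2)) /\
    [set m] `|` \bigcup_(eps in [set e : R | 0 < e < eps0]) gamma eps =
      connected_component (Sigma M `\` gamma eps0) m.
Proof.
(* Choice needs a value at every real; outside the range of energies it is 0. *)
have /choice [T TP] : forall e, exists T, 0 < e <= emax -> [/\ 0 < T,
    level e = [set F t (start e) | t in [set: R]],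
    F T (start e) = start e /\ (forall s, 0 < s < T -> F s (start e) != start e) &
    `|T - 2 * pi / Num.sqrt (beta ^+ 2 - M ^+ 2)| <=
      period_modulus R `|beta| (Num.sg beta * M) * e].
  move=> e; have [he|nhe] := pselect (0 < e <= emax); last by exists 0.
  by have [T TP] := level_periodic e he; exists T.
exists emax, level, T; split => //; split.
  move=> e he; split; first by move=> q [].
  have [T0 lE [FT Tmin] _] := TP e he.
  by split => //; exists (start e).
split.
  move=> eta eta0.
  exists (4 * (`|beta| - `|M|) * Num.min eta (eta ^+ 2 / (4 * `|M| + 1))).
    have M1 : 0 < 4 * `|M| + 1 by rewrite ltr_wpDl // mulr_ge0.
    by rewrite mulr_gt0 ?mulr_gt0 ?subr_gt0 // lt_min eta0 divr_gt0 // exprn_gt0.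
  move=> e /andP[e0 _] ed q [Sq Eq]; apply: (pole_near _ _ _ _ _ Mb) => //.
  by rewrite (energy_level _ _ Eq) normrM sgn1 mul1r gtr0_norm.
split.
  apply/cvgrPdist_lt => eta eta0.
  set k := period_modulus R `|beta| (Num.sg beta * M) in TP.
  (* The modulus is only known to be nonnegative; [k + 1] is safe to divide by. *)
  have k0 : 0 < k + 1 by rewrite ltr_wpDl // period_modulus_ge0 // sg_norm.
  near=> e; have e0 : 0 < e by near: e; exact: nbhs_right_gt.
  have [|_ _ _] := TP e.
    by rewrite e0; near: e; exact: nbhs_right_le.
  rewrite distrC => /le_lt_trans; apply.
  apply: (@lt_trans _ _ ((k + 1) * e)); first by rewrite ltr_pM2r // ltrDl.
  by rewrite -ltr_pdivlMl //; near: e; apply: nbhs_right_lt; rewrite mulr_gt0 ?invr_gt0.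
have -> : [set m] `|` \bigcup_(eps in [set e : R | 0 < e < emax]) level eps =
    [set p | Sigma M p /\ energy p < emax].
  apply/seteqP; split=> [p [->|[e /andP[e0 e1] [Sp Ep]]]|p [Sp ep]] /=.
  - by rewrite energy_m.
  - by rewrite Ep.
  - have [e0|e0] := leP (energy p) 0; first by left; exact: energy_eq0.
    by right; exists (energy p) => //=; rewrite e0.
apply/seteqP; split.
  apply: connected_component_max sublevel_connected => /=; first by rewrite energy_m.
  by move=> p [Sp ep]; split => // -[_ /eqP]; rewrite lt_eqF.
move=> p Cp; have [Sp _] := connected_component_sub Cp; split => //.
(* The energy has an interval as image of the component. Containing 0 and a value at least [emax],
   it would contain [emax], whose level has been removed. *)
rewrite ltNge; apply/negP => ep.
have /connected_intervalP : connected (energy @` connected_component (Sigma M `\` level emax) m).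
  by apply: connected_continuous_connected; [exact: component_connected|exact: continuous_subspaceT].
move=> /(_ 0 (energy p)) h; have [|||q Cq Eq] := h _ _ emax.
- exists m => //; apply: connected_component_refl; split => // -[_].
  by rewrite energy_m => /eqP; rewrite lt_eqF.
- by exists p.
- by rewrite ep ltW.
- by have [Sq] := connected_component_sub Cq; apply; split.
Unshelve. all: by end_near. Qed.
End PeriodicFamily.

(** * Linearization at the pole *)

Section Linearization.
Variable R : realType.
Implicit Types (beta M : R) (v : 'rV[R]_3).

(** At the pole the differential of [Cas] is 2 M dz. *)
Lemma tangent_pole M v : M != 0 -> tangent_space (mkpt 0 0 M) v -> pz v = 0.
Proof.
move=> M0; set m := mkpt 0 0 M; rewrite /tangent_space /=.
have dx := is_derive_coord _ _ _ _ _ _ (inord 0) (is_derive_id m v).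
have dy := is_derive_coord _ _ _ _ _ _ (inord 1) (is_derive_id m v).
have dz := is_derive_coord _ _ _ _ _ _ (inord 2) (is_derive_id m v).
have := is_deriveD (is_deriveM (is_derive_cst (2^-1 : R) m v)
  (is_deriveD (is_deriveM dx dx) (is_deriveM dy dy))) (is_deriveM dz dz).
set f := (X in is_derive _ _ X _).
have -> : f = @Cas R by apply/funext => p; rewrite /f /Cas !expr2.
move=> /@derive_val ->.
rewrite -!/(px _) -!/(py _) -!/(pz _) !pt_mkptE !scale0r !addr0 !scaler0 add0r.
rewrite add0r -mulr2n => /eqP; rewrite mulrn_eq0 /= scaler_eq0 (negPf M0) /=.
by move/eqP.
Qed.

(** For a matrix A with A^2 = kappa, C + S A is exp(tA). The cases are trigonometric, hyperbolic
    and, for [kappa = 0], affine. *)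
Lemma linear_oscillator (kappa : R) : exists C S : R -> R, [/\ C 0 = 1, S 0 = 0,
  forall t, is_derive t (1 : R) C (kappa * S t) & forall t, is_derive t (1 : R) S (C t)].
Proof.
have [k0|k0|k0] := ltgtP kappa 0.
- pose r := Num.sqrt (- kappa).
  have r0 : r != 0 by rewrite gt_eqF // sqrtr_gt0 oppr_gt0.
  have kE : kappa = - (r * r) by rewrite -expr2 sqr_sqrtr ?opprK // oppr_ge0 ltW.
  exists (fun t => cos (r * t)), (fun t => sin (r * t) * r^-1).
  split; rewrite ?mulr0 ?cos0 ?sin0 ?mul0r // => t.
  + by derive_eq_tac; rewrite kE; field.
  + by derive_eq_tac; field.
- pose r := Num.sqrt kappa.
  have r0 : r != 0 by rewrite gt_eqF // sqrtr_gt0.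
  have kE : kappa = r * r by rewrite -expr2 sqr_sqrtr // ltW.
  exists (fun t => 2^-1 * (expR (r * t) + expR (- (r * t)))).
  exists (fun t => (2 * r)^-1 * (expR (r * t) + - expR (- (r * t)))).
  split; rewrite ?mulr0 ?oppr0 ?expR0.
  + by field.
  + by rewrite subrr mulr0.
  + by move=> t; derive_eq_tac; rewrite kE; field.
  + by move=> t; derive_eq_tac; field.
- exists (fun _ => 1), (fun t => t); split => // t.
  + by rewrite k0 mul0r; exact: is_derive_const.
  + exact: is_derive_var.
Qed.

Lemma is_derive_mkpt (f g h : R -> R) t a b c : is_derive t (1 : R) f a ->
  is_derive t (1 : R) g b -> is_derive t (1 : R) h c ->
  is_derive t (1 : R) (fun s => mkpt (f s) (g s) (h s)) (mkpt a b c).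
Proof.
move=> fa gb hc.
have coord i j : is_derive t (1 : R) (fun s => mkpt (f s) (g s) (h s) i j) (mkpt a b c i j).
  rewrite (ord1 i); move: j; apply: ord3_ind.
  - by rewrite -/(px _) px_mkpt; under eq_fun do rewrite -/(px _) px_mkpt.
  - by rewrite -/(py _) py_mkpt; under eq_fun do rewrite -/(py _) py_mkpt.
  - by rewrite -/(pz _) pz_mkpt; under eq_fun do rewrite -/(pz _) pz_mkpt.
have d : derivable (fun s => mkpt (f s) (g s) (h s)) t 1.
  by apply/derivable_mxP => i j; have [] := coord i j.
split => //; rewrite derive_mx //; apply/matrixP => i j; rewrite mxE.
by have [_ ->] := coord i j.
Qed.

(** A crude estimate from (|x| - 1)^2 >= 0, sparing a square root. *)
Lemma sqr_le_of_bound (x A : R) : x ^+ 2 <= A -> `|x| <= 1 + A.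
Proof. by move=> xA; have := sqr_ge0 (`|x| - 1); rewrite sqrrB1 real_normK ?num_real //; nra. Qed.

Lemma two_prod_le (x y k : R) : `|2 * (x * y) * k| <= (x ^+ 2 + y ^+ 2) * `|k|.
Proof.
rewrite normrM ler_wpM2r // ler_norml.
by have := sqr_ge0 (x + y); have := sqr_ge0 (x - y); lra.
Qed.

(* Second-order comparison with the linearized equation, by Gronwall's inequality applied
   first to the distance to the equilibrium, then to the distance to the linear solution. *)
Lemma flow_linear_approx beta M F v (w1 w2 : R -> R) t : is_flow (Xbeta beta) F -> pz v = 0 ->
  w1 0 = px v -> w2 0 = py v ->
  (forall s, is_derive s (1 : R) w1 ((M + beta) * w2 s)) ->
  (forall s, is_derive s (1 : R) w2 ((M - beta) * w1 s)) ->
  exists2 A : R, 0 < A & forall h : R, `|h| <= 1 ->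
    let q := F t (h *: v + mkpt 0 0 M) in
    [/\ `|px q - h * w1 t| <= h ^+ 2 * A, `|py q - h * w2 t| <= h ^+ 2 * A &
        `|pz q - M| <= h ^+ 2 * A].
Proof.
move=> Ff vz w10 w20 w1d w2d.
(* [B] bounds z^2 through the conserved [Cas]. [K1] and [K2] are the Gronwall rates of the two
   comparisons; [A1] and [A2] are the resulting constants, in E <= h^2 A1 and D <= h^4 A2. *)
pose n2 := px v ^+ 2 + py v ^+ 2; have n20 : 0 <= n2 by rewrite addr_ge0 ?sqr_ge0.
pose B := 2^-1 * n2 + M ^+ 2; have B0 : 0 <= B by rewrite addr_ge0 ?sqr_ge0 // mulr_ge0.
pose K1 := 1 + B + `|M|; have K10 : 0 < K1 by rewrite ltr_wpDr // ltr_pwDl.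
pose A1 := n2 * expR (K1 * `|t|).
have A10 : 0 <= A1 by rewrite mulr_ge0 ?expR_ge0.
pose K2 := 2 * `|M| + 1; have K20 : 0 < K2 by rewrite ltr_wpDl // mulr_ge0.
pose A2 := A1 ^+ 2 / K2 * expR (K2 * `|t|).
have A20 : 0 <= A2 by rewrite mulr_ge0 ?expR_ge0 // divr_ge0 ?sqr_ge0 // ltW.
exists (1 + A2); first by rewrite ltr_pwDl.
move=> h h1; set p := h *: v + mkpt 0 0 M; move=> q.
have h2le : h ^+ 2 <= 1 by rewrite -real_normK ?num_real // expr_le1.
have [xd yd zd] := flow_coords _ _ _ p Ff.
pose x s := px (F s p); pose y s := py (F s p); pose z s := pz (F s p).
have x0 : x 0 = h * px v by rewrite /x (proj1 Ff) pxD pxZ px_mkpt addr0.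
have y0 : y 0 = h * py v by rewrite /y (proj1 Ff) pyD pyZ py_mkpt addr0.
have z0 : z 0 = M by rewrite /z (proj1 Ff) pzD pzZ pz_mkpt vz mulr0 add0r.
have {}xd : forall s, is_derive s (1 : R) x ((z s + beta) * y s) := xd.
have {}yd : forall s, is_derive s (1 : R) y ((z s - beta) * x s) := yd.
have {}zd : forall s, is_derive s (1 : R) z (- (x s * y s)) := zd.
have zB s : `|z s| <= 1 + B.
  apply: sqr_le_of_bound.
  have e := solution_casimir _ beta x y z s (And3 xd yd zd).
  have {e} : 2^-1 * (x s ^+ 2 + y s ^+ 2) + z s ^+ 2 = 2^-1 * (h ^+ 2 * n2) + M ^+ 2.
    by rewrite e x0 y0 z0 /n2 !exprMn -mulrDr.
  have : h ^+ 2 * n2 <= n2 by rewrite ler_piMl.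
  by rewrite /B; have := sqr_ge0 (x s); have := sqr_ge0 (y s); lra.
pose E s := x s ^+ 2 + y s ^+ 2 + (z s - M) ^+ 2.
have E0 : E 0 = h ^+ 2 * n2 by rewrite /E x0 y0 z0 subrr expr0n /= addr0 !exprMn -mulrDr.
have Ele s : `|s| <= `|t| -> E s <= h ^+ 2 * A1.
  move=> st; have -> : h ^+ 2 * A1 = (E 0 + 0 / K1) * expR (K1 * `|t|).
    by rewrite /A1 E0 mul0r addr0 mulrA.
  (* The terms in [beta] cancel, leaving E' = 2xy(z + M). *)
  apply: (@gronwall R E (fun u => 2 * (x u * y u) * (z u + M)) K1 0 `|t|) => // u.
    by rewrite /E; derive_eq_tac; ring.
  move=> _; rewrite addr0; apply: le_trans (two_prod_le _ _ _) _.
  rewrite mulrC /E; apply: ler_pM; rewrite ?addr_ge0 ?sqr_ge0 //.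
    by apply: le_trans (ler_normD _ _) _; rewrite lerD2r.
  by rewrite lerDl sqr_ge0.
pose d1 s := x s - h * w1 s; pose d2 s := y s - h * w2 s.
pose D s := d1 s ^+ 2 + d2 s ^+ 2 + (z s - M) ^+ 2.
have D0 : D 0 = 0 by rewrite /D /d1 /d2 x0 y0 z0 w10 w20 !subrr expr0n /= !addr0.
(* The errors satisfy d1' = (M + beta) d2 + Z y, d2' = (M - beta) d1 + Z x, Z' = -xy. The products
   Zy, Zx, xy have squares summing to at most E^2, hence the inhomogeneous term of order h^4. *)
have Dle : D t <= (h ^+ 2) ^+ 2 * A2.
  have -> : (h ^+ 2) ^+ 2 * A2 = (D 0 + (h ^+ 2 * A1) ^+ 2 / K2) * expR (K2 * `|t|).
    by rewrite D0 add0r /A2; ring.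
  pose Z s := z s - M.
  apply: (@gronwall R D (fun u => 2 * (d1 u * d2 u) * (2 * M) + 2 * (d1 u * (Z u * y u)) * 1
    + 2 * (d2 u * (Z u * x u)) * 1 + 2 * (Z u * (x u * y u)) * (-1))) => //.
  - exact: sqr_ge0.
  - by move=> u; rewrite /D /d1 /d2; derive_eq_tac; rewrite /d1 /d2 /Z; ring.
  move=> u ut; apply: le_trans (ler_normD _ _) _.
  have t1 := two_prod_le (d1 u) (d2 u) (2 * M).
  have t2 := two_prod_le (d1 u) (Z u * y u) 1.
  have t3 := two_prod_le (d2 u) (Z u * x u) 1.
  have t4 := two_prod_le (Z u) (x u * y u) (-1).
  rewrite normrN1 in t4; rewrite normr1 in t2 t3; rewrite (normrM 2 M) (ger0_norm (_ : 0 <= 2)) // in t1.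
  have n1 := ler_normD (2 * (d1 u * d2 u) * (2 * M) + 2 * (d1 u * (Z u * y u)) * 1)
    (2 * (d2 u * (Z u * x u)) * 1).
  have n3 := ler_normD (2 * (d1 u * d2 u) * (2 * M)) (2 * (d1 u * (Z u * y u)) * 1).
  have E2 : (Z u * y u) ^+ 2 + (Z u * x u) ^+ 2 + (x u * y u) ^+ 2 <= (h ^+ 2 * A1) ^+ 2.
    apply: (@le_trans _ _ (E u ^+ 2)).
      rewrite /E -/(Z u) !exprMn.
      have := sqr_ge0 (x u); have := sqr_ge0 (y u); have := sqr_ge0 (Z u).
      move: (x u ^+ 2) (y u ^+ 2) (Z u ^+ 2) => X Y W *; nra.
    rewrite ler_pXn2r ?nnegrE ?Ele // /E ?addr_ge0 ?sqr_ge0 //.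
    by rewrite mulr_ge0 // sqr_ge0.
  have M2 : 0 <= 2 * `|M| * Z u ^+ 2 by rewrite mulr_ge0 ?sqr_ge0 // mulr_ge0.
  rewrite /D /K2 -/(Z u); lra.
(* The root of [A2] is replaced by [1 + A2], whose square exceeds [A2]. *)
have small (d : R) : d ^+ 2 <= D t -> `|d| <= h ^+ 2 * (1 + A2).
  have hA : 0 <= h ^+ 2 * (1 + A2) by apply: mulr_ge0; [exact: sqr_ge0|exact: addr_ge0].
  move=> dD; rewrite -(@ler_pXn2r _ 2) ?nnegrE //.
  rewrite real_normK ?num_real // exprMn; apply: le_trans dD (le_trans Dle _).
  by rewrite ler_wpM2l ?sqr_ge0 //; have := sqr_ge0 A2; rewrite sqrrD; lra.
have DE : D t = (px q - h * w1 t) ^+ 2 + (py q - h * w2 t) ^+ 2 + (pz q - M) ^+ 2 by [].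
have qx := sqr_ge0 (px q - h * w1 t); have qy := sqr_ge0 (py q - h * w2 t).
have qz := sqr_ge0 (pz q - M).
split.
- by apply: small; rewrite DE -addrA lerDl addr_ge0.
- by apply: small; rewrite DE addrAC lerDr addr_ge0.
- by apply: small; rewrite DE lerDr addr_ge0.
Qed.

(** For tangent [v] the derivative of the flow along [v] is the solution (w1, w2, 0) of the
    linearized equation starting at [v]; its velocity at time 0 is the value claimed. *)
Lemma linearization_pole beta M F v : is_flow (Xbeta beta) F -> pz v = 0 ->
  linearization F (mkpt 0 0 M) v = mkpt ((M + beta) * py v) ((M - beta) * px v) 0.
Proof.
move=> Ff vz; have [C [S [C0 S0 Cd Sd]]] := linear_oscillator ((M + beta) * (M - beta)).
pose w1 t := px v * C t + (M + beta) * py v * S t.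
pose w2 t := py v * C t + (M - beta) * px v * S t.
have w10 : w1 0 = px v by rewrite /w1 C0 S0 mulr0 addr0 mulr1.
have w20 : w2 0 = py v by rewrite /w2 C0 S0 mulr0 addr0 mulr1.
have w1d s : is_derive s (1 : R) w1 ((M + beta) * w2 s).
  by rewrite /w1; derive_eq_tac; rewrite /w2; ring.
have w2d s : is_derive s (1 : R) w2 ((M - beta) * w1 s).
  by rewrite /w2; derive_eq_tac; rewrite /w1; ring.
rewrite /linearization.
have -> : (fun t => 'D_v (F t) (mkpt 0 0 M)) = fun t => mkpt (w1 t) (w2 t) 0.
  apply/funext => t; set m := mkpt 0 0 M.
  have [A A0 approx] := flow_linear_approx beta M F v w1 w2 t Ff vz w10 w20 w1d w2d.
  (* That the pole is fixed by the flow is the case [h = 0] of the approximation. *)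
  have Fm : F t m = m.
    have [] := approx 0; first by rewrite normr0.
    rewrite /= scale0r add0r expr0n /= !mul0r !subr0 !normr_le0 subr_eq0 -/m.
    by move=> /eqP ? /eqP ? /eqP ?; apply: pt_eq; rewrite pt_mkptE.
  apply/cvg_lim => //; apply/cvgrPdist_lt => eta eta0.
  near=> h.
  have h0 : h != 0 by near: h; exact: nbhs_dnbhs_neq.
  have h1 : `|h| <= 1 by near: h; apply: dnbhs0_le.
  have hA : `|h| < eta / A by near: h; apply: dnbhs0_lt; rewrite divr_gt0.
  have /= [ax ay az] := approx h h1.
  (* After division by [h] the second-order error is at most |h| A, below [eta] for the chosen
     [h]. *)
  have bound (a b : R) : `|a - h * b| <= h ^+ 2 * A -> `|b - h^-1 * a| < eta.
    move=> ab; have -> : b - h^-1 * a = - (h^-1 * (a - h * b)) by field.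
    rewrite normrN normrM normfV ltr_pdivrMl ?normr_gt0 //; apply: le_lt_trans ab _.
    by rewrite -real_normK ?num_real // expr2 -mulrA ltr_pM2l ?normr_gt0 // -ltr_pdivlMr.
  rewrite Fm /=; apply: pt_norm_lt => //;
    rewrite ?(pxB, pyB, pzB, pxZ, pyZ, pzZ) !pt_mkptE ?subr0; apply: bound => //.
  by rewrite mulr0 subr0.
have [_ ->] := is_derive_mkpt _ _ _ _ _ _ _ (w1d 0) (w2d 0) (is_derive_const _ 0 0).
by rewrite w10 w20.
Unshelve. all: by end_near. Qed.
End Linearization.

(** * Characteristic polynomial of the linearization in a basis of the tangent plane *)

Lemma char_poly2 (R : comNzRingType) (A : 'M[R]_2) :
  char_poly A = 'X ^+ 2 - (\tr A)%:P * 'X + (\det A)%:P.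
Proof.
have s := size_char_poly A.
apply/polyP => -[|[|[|i]]]; rewrite !(coefD, coefN, coefCM, coefMX, coefXn, coefX, coefC) /=.
- by rewrite char_poly_det expr2 mulrNN mulr1 mul1r mulr0 subr0 add0r.
- by rewrite (char_poly_trace A) // mulr1 add0r addr0.
- by have /monicP := char_poly_monic A; rewrite lead_coefE s /= mulr0 subr0 addr0.
- by rewrite nth_default ?s // mulr0 subr0 addr0.
Qed.

(** [P] holds the horizontal coordinates of the basis and [L] is the linearization in these
    coordinates. From PA = LP with [P] invertible, [A] is similar to [L], which has trace 0 and
    determinant -(M + beta)(M - beta). *)
Lemma char_poly_linearization (R : realType) (beta M : R) (F : R -> 'rV[R]_3 -> 'rV[R]_3)
    (e : 'I_2 -> 'rV[R]_3) (A : 'M[R]_2) : M != 0 -> is_flow (Xbeta beta) F ->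
  (forall i, tangent_space (mkpt 0 0 M) (e i)) ->
  (forall c : 'I_2 -> R, \sum_i c i *: e i = 0 -> forall i, c i = 0) ->
  (forall j, linearization F (mkpt 0 0 M) (e j) = \sum_i A i j *: e i) ->
  char_poly A = 'X ^+ 2 + (beta ^+ 2 - M ^+ 2)%:P.
Proof.
move=> M0 Ff etan efree eA.
have ez i : pz (e i) = 0 by apply: tangent_pole (etan i).
pose P : 'M[R]_2 := \matrix_(i, j) (if i == 0 then px (e j) else py (e j)).
pose L : 'M[R]_2 := \matrix_(i, j)
  (if i == j then 0 else if i == 0 then M + beta else M - beta).
have Psum (c : 'I_2 -> R) : \sum_i c i *: e i =
    mkpt (\sum_i c i * px (e i)) (\sum_i c i * py (e i)) 0.
  by rewrite !big_ord_recl !big_ord0; apply: pt_eq;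
    rewrite ?(pxD, pyD, pzD, pxZ, pyZ, pzZ) !pt_mkptE ?ez ?/px ?/py ?/pz ?mxE ?mulr0 ?addr0.
have PA : P *m A = L *m P.
  apply/matrixP => i j; have := eA j.
  rewrite (linearization_pole _ beta _ _ _ Ff (ez j)) Psum => h.
  have hx := congr1 (@px R) h; have hy := congr1 (@py R) h.
  rewrite !pt_mkptE in hx hy.
  have [->|->] : i = 0 \/ i = 1 by case: i => -[|[|//]] ?; [left|right]; exact: val_inj.
    rewrite !mxE (eq_bigr (fun k => A k j * px (e k))) => [|k _]; last by rewrite mxE mulrC.
    by rewrite -hx !big_ord_recl big_ord0 !mxE /= mul0r add0r addr0.
  rewrite !mxE (eq_bigr (fun k => A k j * py (e k))) => [|k _]; last by rewrite mxE mulrC.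
  by rewrite -hy !big_ord_recl big_ord0 !mxE /= mul0r !addr0.
(* A kernel vector would be a linear relation between the horizontal parts of the [e i], hence
   between the [e i], whose third coordinates vanish. *)
have PU : P \in unitmx.
  rewrite unitmxE unitfE -det_tr; apply/negP => /eqP /eqP /det0P [c c0 cP].
  move/negP: c0; apply; apply/eqP/rowP => i; rewrite mxE.
  apply: (efree (fun i => c ord0 i)); rewrite Psum.
  have cPi k := congr1 (fun B : 'rV_2 => B ord0 k) cP.
  apply: pt_eq; rewrite pt_mkptE [RHS]mxE //.
    by have := cPi 0; rewrite !mxE => c0k; rewrite -[RHS]c0k; apply: eq_bigr => k _; rewrite !mxE.
  by have := cPi 1; rewrite !mxE => c0k; rewrite -[RHS]c0k; apply: eq_bigr => k _; rewrite !mxE.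
have AE : A = invmx P *m (L *m P) by rewrite -PA mulmxA mulVmx // mul1mx.
rewrite char_poly2.
have -> : \tr A = 0.
  rewrite AE mxtrace_mulC -mulmxA mulmxV // mulmx1.
  by rewrite /mxtrace !big_ord_recl big_ord0 !mxE eqxx !addr0.
have -> : \det A = beta ^+ 2 - M ^+ 2.
  rewrite AE !det_mulmx mulrCA -det_mulmx mulVmx // det1 mulr1.
  rewrite (expand_det_row _ 0) !big_ord_recl big_ord0 /cofactor !det_mx11 !mxE /=.
  by rewrite !mul0r !add0r addr0 expr1; ring.
by rewrite mul0r subr0.
Qed.

Theorem theorem7p2 (R : realType) (beta M : R) (F : R -> 'rV[R]_3 -> 'rV[R]_3) :
  beta != 0 -> M != 0 -> is_flow (Xbeta beta) F ->
  let m := mkpt 0 0 M in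
  (* (a) *)
  (forall (e : 'I_2 -> 'rV[R]_3) (A : 'M[R]_2),
     (forall i, tangent_space m (e i)) ->
     (forall c : 'I_2 -> R, \sum_i c i *: e i = 0 -> forall i, c i = 0) ->
     (forall v, tangent_space m v -> exists c : 'I_2 -> R, v = \sum_i c i *: e i) ->
     (forall j, linearization F m (e j) = \sum_i A i j *: e i) ->
     char_poly A = 'X ^+ 2 + (beta ^+ 2 - M ^+ 2)%:P) /\
  (* (b) *)
  (`|beta| < `|M| -> ~ lyapunov_stable_on (Sigma M) F m) /\
  (* (c) *)
  (`|M| < `|beta| -> lyapunov_stable_on (Sigma M) F m) /\
  (* (d) *)
  (`|M| < `|beta| ->
    exists (eps0 : R) (gamma : R -> set 'rV[R]_3) (T : R -> R),
      0 < eps0 /\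
      (forall eps, 0 < eps <= eps0 ->
         gamma eps `<=` Sigma M /\ periodic_orbit F (gamma eps) (T eps)) /\
      (forall eta : R, 0 < eta -> exists2 d : R, 0 < d &
         forall eps, 0 < eps <= eps0 -> eps < d ->
           forall q, gamma eps q -> `|q - m| < eta) /\
      (T eps @[eps --> 0^'+] --> 2 * pi / Num.sqrt (beta ^+ 2 - M ^+ 2)) /\
      [set m] `|` \bigcup_(eps in [set e : R | 0 < e < eps0]) gamma eps =
        connected_component (Sigma M `\` gamma eps0) m).
Proof.
move=> b0 M0 Ff m; split; last split; last split.
- by move=> e A etan efree _ eA; exact: char_poly_linearization eA.
- exact: unstable.
- exact: stable.
- exact: periodic_family.
Qed.
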